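(* Let $(\mathcal A_n)_{n\ge1}$ be an effective enumeration of all algorithms, and let $\Omega\subset\mathbb C$ be the domain built from $(\mathcal A_n)$ by the construction in the context. Then the compact set $K=\hat{\mathbb C}\setminus\Omega$ is computable.
   Context: Construction of $\Omega$. For $a,b\in\mathbb R$, $[a,b]$ denotes the shortest arc of the unit circle between $e^{2\pi i a}$ and $e^{2\pi i b}$. For $n\ge 10$ define a set $L_n$ as follows. If $\mathcal A_n$ halts, in exactly $l$ steps, put $j=\max(l,8n)$ and $$L_n=L_n^j=\bigcup_{k=1-2^j+2^{j-8n}}^{2^j-2^{j-8n}-1}\left[2^{-n}+k\cdot 2^{-2n-j},\ 2^{-n}+k\cdot 2^{-2n-j}+\exp\left(-2^{2n+2j}\right)\right].$$ If $\mathcal A_n$ does not halt, put $$L_n=L_n^\infty=\left[2^{-n}-2^{-2n}+2^{-10n},\ 2^{-n}+2^{-2n}-2^{-10n}\right].$$ Let $D_n$ be the open disk having as a diameter the segment between $\exp(2\pi i(2^{-n}-2^{-2n}))$ and $\exp(2\pi i(2^{-n}+2^{-2n}))$, let $\mathbb D$ be the open unit disk, and set $\Lambda=\mathbb D\cup\bigcup_{n=10}^\infty D_n$ and $\Omega=\Lambda\setminus\bigcup_{n=10}^\infty L_n$. Computability of a compact set: $\hat{\mathbb C}$ carries the spherical metric, with ideal points the points of $\mathbb Q+i\mathbb Q$; an ideal ball is an open ball with ideal center and positive rational radius. A compact set $K$ is computable if there is an algorithm which on input $m\in\mathbb N$ outputs a finite collection of closed ideal balls whose union is at Hausdorff distance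 less than $2^{-m}$ from $K$. *)

(* Defs.v *)
From HB Require Import structures.
From mathcomp Require Import all_boot all_order all_algebra.
From mathcomp Require Import all_classical all_reals all_analysis.
From mathcomp Require Import complex ring lra.

Set Implicit Arguments.
Unset Strict Implicit.
Unset Printing Implicit Defensive.

Import Order.TTheory GRing.Theory Num.Theory.
Import numFieldNormedType.Exports.
Import ComplexField.Normc.

Local Open Scope classical_set_scope.
Local Open Scope ring_scope.

(* The model of computation: while programs over registers holding natural
   numbers.  [While x p] repeats [p] as long as register [x] is nonzero. *)
Inductive prog : Type :=
| Inc of nat
| Dec of nat
| Seq of prog & prog
| While of nat & prog.

Definition store := nat -> nat.

Definition update (s : store) (x v : nat) : store :=
  fun y => if y == x then v else s y.

(* A configuration is the stack of programs still to be run, and the store. *)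
Definition config := (seq prog * store)%type.

Definition step (c : config) : config :=
  let: (k, s) := c in
  match k with
  | [::] => c
  | Inc x :: k' => (k', update s x (s x).+1)
  | Dec x :: k' => (k', update s x (s x).-1)
  | Seq p q :: k' => (p :: q :: k', s)
  | While x p :: k' => if s x == 0%N then (k', s) else (p :: k, s)
  end.

Definition init (p : prog) (input : nat) : config :=
  ([:: p], update (fun=> 0%N) 0%N input).

Definition run (p : prog) (input l : nat) : config :=
  iter l step (init p input).

Definition halted (c : config) : bool := nilp c.1.

Definition halts_in (p : prog) (input l : nat) : Prop :=
  halted (run p input l) /\ forall i, (i < l)%N -> ~~ halted (run p input i).

(* Algorithms are started on a blank store, hence on the input 0. *)
Definition halts_in_exactly (p : prog) (l : nat) : Prop := halts_in p 0%N l.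

Definition computable (f : nat -> nat) : Prop :=
  exists p, forall n, exists2 l, halts_in p n l & (run p n l).2 0%N = f n.

(* Goedel numbers, by means of the bijection CodeSeq.code : seq nat -> nat. *)
Fixpoint prog_code (p : prog) : nat :=
  match p with
  | Inc x => CodeSeq.code [:: 0; x]
  | Dec x => CodeSeq.code [:: 1; x]
  | Seq p q => CodeSeq.code [:: 2; prog_code p; prog_code q]
  | While x p => CodeSeq.code [:: 3; x; prog_code p]
  end%N.

(* Only the terms with index n >= 1 matter. *)
Definition effective_enumeration (A : nat -> prog) : Prop :=
  (forall p, exists2 n, (0 < n)%N & A n = p) /\
  (exists2 f, computable f & forall n, (0 < n)%N -> f n = prog_code (A n)).

(* The code of [:: a; b; c] represents (a - b) / (c + 1). *)
Definition rat_of_code (w : nat) : rat :=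
  let s := CodeSeq.decode w in
  ((nth 0%N s 0)%:R - (nth 0%N s 1)%:R) / (nth 0%N s 2).+1%:R.

(* Center x + iy and radius r of a ball, as the triple (x, y, r). *)
Definition ball_of_code (w : nat) : rat * rat * rat :=
  let s := CodeSeq.decode w in
  (rat_of_code (nth 0%N s 0), rat_of_code (nth 0%N s 1),
   rat_of_code (nth 0%N s 2)).

Definition balls_of_code (w : nat) : seq (rat * rat * rat) :=
  map ball_of_code (CodeSeq.decode w).

(* The Riemann sphere; [None] is the point at infinity. *)
Definition sphere (R : realType) : Type := option R[i].

Section Sphere.
Variable R : realType.
Implicit Types x y z : sphere R.

(* Inverse of the stereographic projection of the unit sphere of R^3. *)
Definition stereo x : R * R * R :=
  if x is Some w then
    let q := complex.Re w ^+ 2 + complex.Im w ^+ 2 in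
    (2 * complex.Re w / (q + 1), 2 * complex.Im w / (q + 1), (q - 1) / (q + 1))
  else (0, 0, 1).

Definition dot3 (u v : R * R * R) : R :=
  u.1.1 * v.1.1 + u.1.2 * v.1.2 + u.2 * v.2.

(* The geodesic distance of the metric 2|dz| / (1 + |z|^2). *)
Definition sphere_dist x y : R := acos (dot3 (stereo x) (stereo y)).

Let den_neq0 (a b : R) : a ^+ 2 + b ^+ 2 + 1 != 0.
Proof. by rewrite gt_eqF// ltr_wpDl// addr_ge0// sqr_ge0. Qed.

Lemma dot3_stereoxx x : dot3 (stereo x) (stereo x) = 1.
Proof.
case: x => [[a b]|]; rewrite /dot3 /=; last by ring.
by field; exact: den_neq0.
Qed.

Let dot3C (u v : R * R * R) : dot3 u v = dot3 v u.
Proof. by rewrite /dot3; ring. Qed.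

Let gram (u v w : R * R * R) : dot3 u u = 1 -> dot3 v v = 1 -> dot3 w w = 1 ->
  (dot3 u w - dot3 u v * dot3 v w) ^+ 2 <=
  (1 - dot3 u v ^+ 2) * (1 - dot3 v w ^+ 2).
Proof.
move=> u1 v1 w1; rewrite -subr_ge0.
suff -> : (1 - dot3 u v ^+ 2) * (1 - dot3 v w ^+ 2) -
    (dot3 u w - dot3 u v * dot3 v w) ^+ 2 =
    (u.1.1 * (v.1.2 * w.2 - v.2 * w.1.2)
     - u.1.2 * (v.1.1 * w.2 - v.2 * w.1.1)
     + u.2 * (v.1.1 * w.1.2 - v.1.2 * w.1.1)) ^+ 2 by exact: sqr_ge0.
transitivity (dot3 u u * dot3 v v * dot3 w w
  + 2 * dot3 u v * dot3 v w * dot3 u w - dot3 u u * dot3 v w ^+ 2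
  - dot3 v v * dot3 u w ^+ 2 - dot3 w w * dot3 u v ^+ 2).
  by rewrite u1 v1 w1; ring.
by rewrite /dot3; ring.
Qed.

Let dot3_itv x y : -1 <= dot3 (stereo x) (stereo y) <= 1.
Proof.
have := dot3_stereoxx x; have := dot3_stereoxx y.
move: (stereo x) (stereo y) => u v; rewrite /dot3 => v1 u1.
have := sqr_ge0 (u.1.1 - v.1.1); have := sqr_ge0 (u.1.2 - v.1.2).
have := sqr_ge0 (u.2 - v.2); have := sqr_ge0 (u.1.1 + v.1.1).
have := sqr_ge0 (u.1.2 + v.1.2); have := sqr_ge0 (u.2 + v.2).
by move=> *; apply/andP; split; nra.
Qed.

Lemma sphere_distxx x : sphere_dist x x = 0.
Proof. by rewrite /sphere_dist dot3_stereoxx acos1. Qed.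

Lemma sphere_dist_sym x y : sphere_dist x y = sphere_dist y x.
Proof. by rewrite /sphere_dist dot3C. Qed.

Lemma stereo_inj : injective stereo.
Proof.
have last_lt1 (a b : R) : (a ^+ 2 + b ^+ 2 - 1) / (a ^+ 2 + b ^+ 2 + 1) != 1.
  apply/eqP => /(congr1 (fun t => t * (a ^+ 2 + b ^+ 2 + 1))).
  by rewrite divfK ?den_neq0// mul1r; lra.
move=> [[a b]|] [[c d]|]//= [].
- move=> e1 e2 e3.
  have nz := den_neq0 a b; have nz' := den_neq0 c d.
  have qE : a ^+ 2 + b ^+ 2 + 1 = c ^+ 2 + d ^+ 2 + 1.
    move: e3 => /(congr1 (fun t => 1 - t)) e3.
    have h (q : R) : q + 1 != 0 -> 1 - (q - 1) / (q + 1) = 2 / (q + 1).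
      by move=> q0; field.
    move: e3; rewrite !h// => /(mulfI _) e3; apply: invr_inj; apply: e3.
    by rewrite pnatr_eq0.
  move: e1 e2; rewrite qE => /(mulIf (invr_neq0 nz')) e1.
  move=> /(mulIf (invr_neq0 nz')) e2.
  by congr (Some (_ +i* _)%C); lra.
- by move=> _ _ /eqP; rewrite (negbTE (last_lt1 _ _)).
- by move=> _ _ /esym/eqP; rewrite (negbTE (last_lt1 _ _)).
Qed.

Lemma sphere_dist_positivity x y : sphere_dist x y = 0 -> x = y.
Proof.
move=> /(congr1 cos); rewrite cos0 /sphere_dist acosK; last first.
  by rewrite in_itv; exact: dot3_itv.
move=> xy1; apply: stereo_inj; move: xy1 (dot3_stereoxx x) (dot3_stereoxx y).
move: (stereo x) (stereo y) => [[u1 u2] u3] [[v1 v2] v3]; rewrite /dot3 /=.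
move=> uv uu vv.
have sum0 : (u1 - v1) ^+ 2 + (u2 - v2) ^+ 2 + (u3 - v3) ^+ 2 = 0.
  transitivity (u1 * u1 + u2 * u2 + u3 * u3 + (v1 * v1 + v2 * v2 + v3 * v3)
    - 2 * (u1 * v1 + u2 * v2 + u3 * v3)); first by ring.
  by rewrite uv uu vv; ring.
move/eqP: sum0; rewrite paddr_eq0 ?addr_ge0 ?sqr_ge0//.
rewrite paddr_eq0 ?sqr_ge0// !sqrf_eq0 !subr_eq0.
by move=> /andP[/andP[/eqP-> /eqP->] /eqP->].
Qed.

Lemma sphere_dist_triangle y x z :
  sphere_dist x z <= sphere_dist x y + sphere_dist y z.
Proof.
rewrite /sphere_dist.
set p := dot3 (stereo x) (stereo y); set q := dot3 (stereo y) (stereo z).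
set r := dot3 (stereo x) (stereo z).
have [pB qB rB] : [/\ -1 <= p <= 1, -1 <= q <= 1 & -1 <= r <= 1].
  by split; exact: dot3_itv.
have [pi_le|lt_pi] := leP pi (acos p + acos q).
  by rewrite (le_trans (acos_lepi rB)).
rewrite leNgt; apply/negP => lt_r.
have : cos (acos r) < cos (acos p + acos q).
  have inr : acos r \in `[0, pi] by rewrite in_itv/= acos_ge0 ?acos_lepi.
  have inpq : acos p + acos q \in `[0, pi].
    by rewrite in_itv/= addr_ge0 ?acos_ge0//= ltW.
  by rewrite (ltr_cos inpq inr).
rewrite cosD !acosK ?in_itv// !sin_acos//; apply/negP; rewrite -leNgt.
have ge0 (t : R) : -1 <= t <= 1 -> 0 <= 1 - t ^+ 2 by move=> /andP[? ?]; nra.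
rewrite lerBlDl -lerBlDr -sqrtrM ?ge0//.
apply: le_trans (ler_wsqrtr (gram (dot3_stereoxx x) (dot3_stereoxx y)
  (dot3_stereoxx z))).
by rewrite -/p -/q -/r sqrtr_sqr -normrN opprB ler_norm.
Qed.

End Sphere.

HB.instance Definition _ (R : realType) := Choice.on (sphere R).
HB.instance Definition _ (R : realType) := isMetric.Build R (sphere R)
  (@sphere_distxx R) (@sphere_dist_positivity R) (@sphere_dist_sym R)
  (@sphere_dist_triangle R).

Section Computable_compact.
Variable R : realType.

Definition hausdorff_dist (T : metricType R) (A B : set T) : \bar R :=
  let excess (A B : set T) :=
    ereal_sup [set ereal_inf [set (mdist a b)%:E | b in B] | a in A] in
  maxe (excess A B) (excess B A).

Definition closed_ideal_ball (b : rat * rat * rat) : set (sphere R) :=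
  closed_ball (Some (ratr b.1.1 +i* ratr b.1.2)%C : sphere R) (ratr b.2).

Definition computable_compact (K : set (sphere R)) : Prop :=
  compact K /\
  exists2 f : nat -> nat, computable f & forall m,
    let balls := balls_of_code (f m) in
    (forall b, b \in balls -> 0 < b.2) /\
    (hausdorff_dist (\bigcup_(b in [set` balls]) closed_ideal_ball b) K
       < (2 ^- m)%:E)%E.

End Computable_compact.

Section Construction.
Variable R : realType.

(* exp(2 pi i t) *)
Definition circle_point (t : R) : R[i] :=
  (cos (2 * pi * t) +i* sin (2 * pi * t))%C.

(* [delta] is the representative of b - a modulo 1 in [-1/2, 1/2[, so that one
   of the two half circles is selected when the end points are antipodal. *)
Definition shortest_arc (a b : R) : set R[i] :=
  let delta := b - a - (Num.floor (b - a + 1 / 2))%:~R in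
  [set circle_point (a + s * delta) | s in `[0, 1]].

Definition L_fin (n j : nat) : set R[i] :=
  \bigcup_(k in [set k : int | 1 - 2 ^+ j + 2 ^+ (j - 8 * n) <= k
                               <= 2 ^+ j - 2 ^+ (j - 8 * n) - 1])
    let a := 2 ^- n + k%:~R * 2 ^- (2 * n + j) in
    shortest_arc a (a + expR (- 2 ^+ (2 * n + 2 * j))).

Definition L_inf (n : nat) : set R[i] :=
  shortest_arc (2 ^- n - 2 ^- (2 * n) + 2 ^- (10 * n))
               (2 ^- n + 2 ^- (2 * n) - 2 ^- (10 * n)).

Definition Lset (A : nat -> prog) (n : nat) : set R[i] :=
  [set z | (exists2 l, halts_in_exactly (A n) l & L_fin n (maxn l (8 * n)) z) \/
           ((forall l, ~ halts_in_exactly (A n) l) /\ L_inf n z)].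

Definition disk_on_diameter (u v : R[i]) : set R[i] :=
  [set z | normc (z - (u + v) / 2) < normc (u - v) / 2].

Definition Ddisk (n : nat) : set R[i] :=
  disk_on_diameter (circle_point (2 ^- n - 2 ^- (2 * n)))
                   (circle_point (2 ^- n + 2 ^- (2 * n))).

Definition Lambda : set R[i] :=
  [set z | normc z < 1] `|` \bigcup_(n in [set n | (10 <= n)%N]) Ddisk n.

Definition Omega (A : nat -> prog) : set R[i] :=
  Lambda `\` \bigcup_(n in [set n | (10 <= n)%N]) Lset A n.

End Construction.

Arguments Lambda R : clear implicits.
Arguments Omega R A : clear implicits.

(* Main.v *)
(* The complement K of Omega consists of the complement of Lambda and of the arcs
   L_n.  By Thales, p lies outside D_n iff F_n(p) = (p - u).(p - v) >= 0, where u
   and v are the end points of the diameter, and for |p| >= 1 the dilation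
   p -> (1 + h) p increases F_n by at least h^2 |p|^2.  Hence approximate values of
   u and v select, among the points of a fine grid, a set that is close to the
   complement of Lambda; the discs and arcs with n >= s may be ignored, because
   they are 2^-s-close to the point 1 of K.

   The only undecidable datum is whether the n-th machine halts, but the sets L_n^j
   converge to L_n^infinity: after simulating 8 s steps, either j is known exactly,
   or L_n^(8s) is 2^-s-close to L_n whether or not the machine halts later.

   The points exp(2 pi i t) are approximated without computing pi, by powers of the
   rational rotation (M^2 - 1 + 2 i M) / (M^2 + 1), whose angle is measured by the
   number of steps that it takes to leave the first quadrant. *)
Require Import Defs.
From mathcomp Require Import all_boot all_order all_algebra.
From mathcomp Require Import all_classical all_reals all_analysis.
From mathcomp Require Import complex ring lra zify.

Set Implicit Arguments.
Unset Strict Implicit.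
Unset Printing Implicit Defensive.

Import Order.TTheory GRing.Theory Num.Theory.
Import numFieldNormedType.Exports.
Import ComplexField.Normc.

Local Open Scope classical_set_scope.

(** * While programs *)

(** Computability is stated for concrete while programs, so every function the algorithm uses, an
    interpreter of while programs included, must be realised by such a program. Hence the class
    [cf], closed under loops and calls, and arithmetic on naturals arranged to avoid negative
    numbers. One parameter [s = m + 10] governs all precisions. Put z = 2^-s. Dilating by 1 + z^3
    moves points with coordinates up to 2 / z by a multiple of z^2 only, yet gains z^6 |p|^2 in each
    power F_n. Mesh and angles are accurate to order z^7, which costs at most 208 z^7 |p|; this is
    less than the gain because 208 z <= 1 <= |p|. The same comparison is used in both directions: a
    point of K is dilated and then rounded to an accepted grid point, and an accepted grid point is
    dilated to land in K. For n < s the simulated level j is at most 8 s, so all exponents 2 n + 2 j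
    stay below 18 s, and the precision 2^(-20 s) suffices for the arcs. Whether a machine halts is
    decided, classically, only in the correctness proof. *)

Definition exec (p : prog) (s s' : store) : Prop :=
  forall K, exists l, iter l step (p :: K, s) = (K, s').

Lemma exec_inc x s : exec (Inc x) s (update s x (s x).+1).
Proof. by move=> K; exists 1%N. Qed.

Lemma exec_dec x s : exec (Dec x) s (update s x (s x).-1).
Proof. by move=> K; exists 1%N. Qed.

Lemma exec_seq p q s1 s2 s3 : exec p s1 s2 -> exec q s2 s3 ->
  exec (Seq p q) s1 s3.
Proof.
move=> hp hq K; have [l1 e1] := hp (q :: K); have [l2 e2] := hq K.
by exists (l2 + l1.+1)%N; rewrite iterD iterSr /= e1.
Qed.

Lemma exec_while0 x p s : s x = 0%N -> exec (While x p) s s.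
Proof. by move=> sx0 K; exists 1%N; rewrite /= sx0. Qed.

Lemma exec_whileS x p s1 s2 s3 : s1 x != 0%N -> exec p s1 s2 ->
  exec (While x p) s2 s3 -> exec (While x p) s1 s3.
Proof.
move=> sx0 hp hw K; have [l1 e1] := hp (While x p :: K); have [l2 e2] := hw K.
by exists (l2 + l1.+1)%N; rewrite iterD iterSr /= (negbTE sx0) e1.
Qed.

(** [exec] quantifies over the rest of the stack, which is what lets programs be composed. The
    postcondition form lets the rules below be applied backwards, the intermediate stores being
    found by unification. *)
Definition runs (p : prog) (s : store) (Q : store -> Prop) : Prop :=
  exists2 s', exec p s s' & Q s'.

Lemma runs_imp p s (Q Q' : store -> Prop) : (forall s', Q s' -> Q' s') ->
  runs p s Q -> runs p s Q'.
Proof. by move=> QQ' [s' ps' Qs']; exists s' => //; exact: QQ'. Qed.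

Lemma runs_inc x s (Q : store -> Prop) : Q (update s x (s x).+1) ->
  runs (Inc x) s Q.
Proof. by move=> Qs; exists (update s x (s x).+1) => //; exact: exec_inc. Qed.

Lemma runs_dec x s (Q : store -> Prop) : Q (update s x (s x).-1) ->
  runs (Dec x) s Q.
Proof. by move=> Qs; exists (update s x (s x).-1) => //; exact: exec_dec. Qed.

Lemma runs_seq p q s Q : runs p s (runs q ^~ Q) -> runs (Seq p q) s Q.
Proof.
by move=> [s1 ps1 [s2 qs2 Qs2]]; exists s2 => //; exact: exec_seq ps1 qs2.
Qed.

(** The loops verified with this rule lower their control register by one per turn, so the invariant
    can be indexed by its value, and termination is induction on that value. *)
Lemma runs_while (I : nat -> store -> Prop) x p s (Q : store -> Prop) :
  (forall n s1, I n s1 -> s1 x = n) ->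
  (forall n s1, I n.+1 s1 -> runs p s1 (I n)) ->
  (forall s1, I 0%N s1 -> Q s1) ->
  I (s x) s -> runs (While x p) s Q.
Proof.
move=> Ix Ip IQ; move: {1 3}(s x) (erefl (s x)) => n.
elim: n s => [|n IHn] s sx Is.
  by exists s; [exact/exec_while0/esym | exact: IQ].
have [s1 ps1 Is1] := Ip _ _ Is.
have [s2 ws2 Qs2] := IHn s1 (esym (Ix _ _ Is1)) Is1.
by exists s2 => //; apply: exec_whileS ps1 ws2; rewrite -sx.
Qed.

Lemma updateE s x v y : update s x v y = if y == x then v else s y.
Proof. by []. Qed.

Ltac upd := rewrite !updateE ?eqxx; do ?(rewrite ifN; last by lia); rewrite ?eqxx.

Definition clear x := While x (Dec x).

Lemma runs_clear x s (Q : store -> Prop) :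
  Q (update s x 0%N) -> runs (clear x) s Q.
Proof.
move=> Qs.
apply: (@runs_while (fun n s1 => s1 = update s x n)) => [n s1 ->|n s1 ->|s1 ->|].
- by rewrite updateE eqxx.
- apply: runs_dec; apply/funext => y; rewrite !updateE eqxx /=.
  by case: (y == x).
- exact: Qs.
- by apply/funext => y; rewrite !updateE; case: eqP => // ->.
Qed.

Definition move x y := Seq (clear y) (While x (Seq (Dec x) (Inc y))).

Lemma runs_move x y s (Q : store -> Prop) : x != y ->
  Q (update (update s y (s x)) x 0%N) -> runs (move x y) s Q.
Proof.
move=> xy Qs; have yx : y != x by rewrite eq_sym.
apply: runs_seq; apply: runs_clear.
apply: (@runs_while (fun n s1 => (n <= s x)%N /\
   s1 = update (update s y (s x - n)%N) x n)) => [n s1 [_ ->]|n s1 [nx ->]|s1 [_ ->]|].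
- by rewrite updateE eqxx.
- apply: runs_seq; apply: runs_dec; apply: runs_inc; split; first by lia.
  apply/funext => z; rewrite !updateE !eqxx (negbTE yx).
  case: (eqVneq z y) => [->|zy]; last by case: (z == x).
  by rewrite (negbTE yx); lia.
- by rewrite subn0.
- rewrite !updateE (negbTE xy) subnn; split=> //.
  apply/funext => z; rewrite !updateE; case: (eqVneq z x) => [->|//].
  by rewrite (negbTE xy).
Qed.

Definition copy x y z :=
  Seq (clear y) (Seq (clear z)
  (Seq (While x (Seq (Dec x) (Seq (Inc y) (Inc z)))) (move z x))).

Lemma runs_copy x y z s (Q : store -> Prop) : x != y -> x != z -> y != z ->
  Q (update (update s y (s x)) z 0%N) -> runs (copy x y z) s Q.
Proof.
move=> xy xz yz Qs; have [yx zx zy] : [/\ y != x, z != x & z != y].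
  by rewrite !(eq_sym z) eq_sym.
apply: runs_seq; apply: runs_clear; apply: runs_seq; apply: runs_clear.
apply: runs_seq.
apply: (@runs_while (fun n s1 => (n <= s x)%N /\
  s1 = update (update (update s y (s x - n)%N) z (s x - n)%N) x n))
   => [n s1 [_ ->]|n s1 [nx ->]|s1 [_ ->]|].
- by rewrite updateE eqxx.
- apply: runs_seq; apply: runs_dec; apply: runs_seq; apply: runs_inc.
  apply: runs_inc; split; first by lia.
  apply/funext => t; rewrite !updateE !eqxx ?(negbTE xy) ?(negbTE xz) ?(negbTE yx)
    ?(negbTE zx) ?(negbTE yz) ?(negbTE zy).
  case: (eqVneq t z) => [->|tz]; first by rewrite (negbTE zx); lia.
  case: (eqVneq t y) => [->|ty]; last by case: (t == x).
  by rewrite (negbTE yx); lia.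
- apply: runs_move; first by rewrite eq_sym.
  congr Q: Qs; apply/funext => t; rewrite !updateE (negbTE zx) eqxx subn0.
  case: (eqVneq t z) => // tz; case: (eqVneq t x) => [->|//].
  by rewrite (negbTE xy).
- rewrite !updateE (negbTE xy) (negbTE xz) subnn; split=> //.
  apply/funext => t; rewrite !updateE; case: (eqVneq t x) => [->|_].
    by rewrite (negbTE xy) (negbTE xz).
  by case: (t == z).
Qed.

(** * Functions of the store computed by programs *)

Definition agree k (s s' : store) : Prop := forall x, (x < k)%N -> s x = s' x.

Lemma agree_update k s s' x v : (k <= x)%N -> agree k s s' ->
  agree k s (update s' x v).
Proof.
by move=> kx a y yk; rewrite updateE ifN ?a// neq_ltn (leq_trans yk kx).
Qed.

Lemma agree_trans k s1 s2 s3 : agree k s1 s2 -> agree k s2 s3 -> agree k s1 s3.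
Proof. by move=> a b x xk; rewrite a// b. Qed.

Lemma agree_le k k' s s' : (k <= k')%N -> agree k' s s' -> agree k s s'.
Proof. by move=> kk' a x xk; rewrite a// (leq_trans xk). Qed.

(* [F] depends on the first [k] registers only.  Quantifying over the output
   register [k'] makes composition possible without renaming registers: those
   below [k'] are preserved, those above are scratch space. *)
Definition cf k (F : store -> nat) : Prop :=
  (forall s s', agree k s s' -> F s = F s') /\
  forall k', (k <= k')%N -> exists p, forall s,
    runs p s (fun s' => agree k' s s' /\ s' k' = F s).

Lemma cf_le k k' F : (k <= k')%N -> cf k F -> cf k' F.
Proof.
move=> kk' [ext run]; split=> [s s' a|l k'l]; first exact/ext/(agree_le kk').
by apply: run; exact: leq_trans kk' k'l.
Qed.

Lemma cf_var k x : (x < k)%N -> cf k (fun s => s x).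
Proof.
move=> xk; split=> [s s' /(_ _ xk)//|l kl]; exists (copy x l l.+1) => s.
have xl : (x < l)%N by exact: leq_trans xk kl.
apply: runs_copy; [by lia..|split].
  by apply: agree_update; [lia|apply: agree_update].
by rewrite !updateE ifN ?eqxx //; lia.
Qed.

Lemma cf_0 k : cf k (fun=> 0%N).
Proof.
split=> // l kl; exists (clear l) => s; apply: runs_clear.
by split; [exact: agree_update|rewrite updateE eqxx].
Qed.

Lemma cf_S k F : cf k F -> cf k (fun s => (F s).+1).
Proof.
move=> [ext run]; split=> [s s' a|l kl]; first by rewrite (ext _ _ a).
have [p hp] := run _ kl; exists (Seq p (Inc l)) => s.
apply: runs_seq; apply: runs_imp (hp s) => s' [a e].
by apply: runs_inc; split; [exact: agree_update|rewrite updateE eqxx e].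
Qed.

Lemma cf_const k n : cf k (fun=> n).
Proof. by elim: n => [|n IHn]; [exact: cf_0|exact: cf_S IHn]. Qed.

(* Higher-order abstract syntax: the bound variables of the loop body are
   represented by arbitrary computable functions [I] and [X]. *)
Lemma cf_iteri k T B (S : nat -> nat -> store -> nat) :
  cf k T -> cf k B ->
  (forall k' I X, (k <= k')%N -> cf k' I -> cf k' X ->
    cf k' (fun s => S (I s) (X s) s)) ->
  cf k (fun s => iteri (T s) (fun i a => S i a s) (B s)).
Proof.
move=> [Text Trun] [Bext Brun] hS.
(* Instantiating the bound variables by constants shows that the body, too, depends on the first [k]
   registers only. *)
have Sext i a s s' : agree k s s' -> S i a s = S i a s'.
  by move: s s'; have [] := hS k _ _ (leqnn k) (cf_const k i) (cf_const k a).
split=> [s s' a|l kl].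
  rewrite (Text _ _ a) (Bext _ _ a); elim: (T s') => //= n ->; exact: Sext.
have [pT hT] := Trun l.+2 ltac:(lia); have [pB hB] := Brun l.+3 ltac:(lia).
have [_ /(_ l.+3 (leqnn _)) [pS hS']] :=
  hS l.+3 (fun s => s l) (fun s => s l.+1) ltac:(lia)
    (@cf_var l.+3 l ltac:(lia)) (@cf_var l.+3 l.+1 ltac:(lia)).
(* Layout: [l] counts the turns made, [l.+1] holds the accumulator, [l.+2] the turns left, and
   [l.+3] receives the value of the body, whose scratch space lies above. *)
exists (Seq pT (Seq pB (Seq (move l.+3 l.+1) (Seq (clear l) (Seq (While l.+2
  (Seq (Dec l.+2) (Seq pS (Seq (move l.+3 l.+1) (Inc l))))) (move l.+1 l)))))) => s.
apply: runs_seq; apply: runs_imp (hT s) => s1 [a1 e1].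
apply: runs_seq; apply: runs_imp (hB s1) => s2 [a2 e2].
have s2T : s2 l.+2 = T s by rewrite -(a2 l.+2).
apply: runs_seq; apply: runs_move; first by lia.
apply: runs_seq; apply: runs_clear; apply: runs_seq.
set f := fun i a => S i a s.
apply: (@runs_while (fun n s' => [/\ agree l s s', s' l.+2 = n, (n <= T s)%N,
    s' l = (T s - n)%N & s' l.+1 = iteri (T s - n) f (B s)])).
- by move=> n s' [].
- move=> n s' [a e nT el el1]; apply: runs_seq; apply: runs_dec.
  apply: runs_seq; set s3 := update _ _ _.
  have s3l : s3 l = (T s - n.+1)%N by rewrite /s3 updateE ifN ?el//; lia.
  have s3l1 : s3 l.+1 = iteri (T s - n.+1) f (B s) by rewrite /s3 updateE ifN ?el1//; lia.
  apply: runs_imp (hS' s3) => s4 [a4 e4]; apply: runs_seq; apply: runs_move => //.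
    by lia.
  apply: runs_inc; split.
  + apply: agree_update => //; apply: agree_update; first by lia.
    apply: agree_update; first by lia.
    apply: agree_trans (agree_le _ a4); last by lia.
    by apply: agree_update => //; lia.
  + rewrite !updateE !ifN -?(a4 l.+2) //; try by lia.
    by rewrite /s3 updateE eqxx e.
  + by lia.
  + rewrite updateE eqxx !updateE !ifN -?(a4 l) ?s3l//; lia.
  + upd; rewrite e4 s3l s3l1.
    have -> : (T s - n = (T s - n.+1).+1)%N by lia.
    rewrite /= /f; apply: Sext => x xk.
    by rewrite /s3; upd; rewrite (a x)//; lia.
- move=> s' [a e _ el el1]; apply: runs_move; first by lia.
  split; first by do !(apply: agree_update; first by lia).
  by rewrite updateE ifN ?updateE ?eqxx ?el1 ?subn0//; lia.
- have -> : update (update (update s2 l.+1 (s2 l.+3)) l.+3 0) l 0 l.+2 = T s.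
    by rewrite !updateE !ifN //; lia.
  split=> //.
  + do !(apply: agree_update; first by lia).
    apply: (@agree_trans _ _ s1); first by apply: agree_le a1; lia.
    by apply: agree_le a2; lia.
  + by rewrite updateE eqxx subnn.
  + rewrite updateE ifN; last by lia.
    rewrite updateE ifN; last by lia.
    rewrite updateE eqxx e2 subnn /=; apply/esym/Bext/agree_le/a1; lia.
Qed.

(** * Calling a given program as a subroutine *)

Fixpoint shift k (p : prog) : prog :=
  match p with
  | Inc x => Inc (x + k)
  | Dec x => Dec (x + k)
  | Seq p q => Seq (shift k p) (shift k q)
  | While x p => While (x + k) (shift k p)
  end%N.

Fixpoint regs_below b (p : prog) : bool :=
  match p with
  | Inc x => x < b
  | Dec x => x < b
  | Seq p q => regs_below b p && regs_below b q
  | While x p => (x < b) && regs_below b p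
  end%N.

Lemma regs_below_le b b' p : (b <= b')%N -> regs_below b p -> regs_below b' p.
Proof.
move=> bb'; elim: p => //= [x|x|p IHp q IHq|x p IHp].
- by move=> /leq_trans; apply.
- by move=> /leq_trans; apply.
- by move=> /andP[/IHp-> /IHq->].
- by move=> /andP[/leq_trans-> // /IHp->].
Qed.

Lemma regs_belowP p : exists b, regs_below b p.
Proof.
elim: p => //= [x|x|p [b hb] q [b' hb']|x p [b hb]].
- by exists x.+1.
- by exists x.+1.
- exists (maxn b b'); rewrite (regs_below_le _ hb) ?leq_maxl//.
  by rewrite (regs_below_le _ hb') ?leq_maxr.
- exists (maxn b x.+1); rewrite (regs_below_le _ hb) ?leq_maxl// andbT.
  by rewrite leq_max ltnSn orbT.
Qed.

(** On an empty stack the original machine idles while the relocated one goes on with [K], hence the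
    condition on [size ks]. In [shift_run] it follows from the minimality of the halting time. *)
Lemma shift_step k b (ks : seq prog) (s t : store) :
  (0 < size ks)%N -> all (regs_below b) ks ->
  (forall x, (x < b)%N -> t (x + k)%N = s x) ->
  exists t', [/\ forall K, step (map (shift k) ks ++ K, t) =
                   (map (shift k) (step (ks, s)).1 ++ K, t'),
    all (regs_below b) (step (ks, s)).1, agree k t t' &
    forall x, (x < b)%N -> t' (x + k)%N = (step (ks, s)).2 x].
Proof.
case: ks => [//|[x|x|p q|x p] ks] _ /= /andP[hp hks] ts.
- exists (update t (x + k) (t (x + k)).+1); split=> //.
    by apply: agree_update => //; lia.
  by move=> y yb; rewrite !updateE eqn_add2r !ts.
- exists (update t (x + k) (t (x + k)).-1); split=> //.
    by apply: agree_update => //; lia.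
  by move=> y yb; rewrite !updateE eqn_add2r !ts.
- by exists t; split=> //=; rewrite andbA in hp *; rewrite hp hks.
- move/andP: hp => [xb hp]; exists t; rewrite ts//.
  by case: eqP => //= _; rewrite xb hp hks.
Qed.

Lemma shift_run k b p n l (t : store) :
  halts_in p n l -> regs_below b p ->
  (forall x, (x < b)%N -> t (x + k)%N = (init p n).2 x) ->
  exists t', [/\ exec (shift k p) t t', agree k t t' &
    forall x, (x < b)%N -> t' (x + k)%N = (run p n l).2 x].
Proof.
move=> [hl hlt] pb t0.
suff: exists t', [/\ forall K, iter l step (shift k p :: K, t) =
      (map (shift k) (run p n l).1 ++ K, t'),
      all (regs_below b) (run p n l).1, agree k t t' &
      forall x, (x < b)%N -> t' (x + k)%N = (run p n l).2 x].
  by move: hl => /nilP ->; case=> t' [e _ a h]; exists t'; split=> // K; exists l.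
have: forall i, (i < l)%N -> ~~ halted (run p n i) by [].
move=> {hl} hlt'; elim: l {hlt} hlt' => [_|l IHl hlt].
  by exists t; split=> //=; rewrite pb.
have [|t' [e h1 a h2]] := IHl; first by move=> i il; apply: hlt; lia.
have hne : (0 < size (run p n l).1)%N.
  by have := hlt l (ltnSn l); rewrite /halted /nilp lt0n.
have [t'' [e' h1' a' h2']] := shift_step hne h1 h2.
move: e' h1' h2'; rewrite -surjective_pairing => e' h1' h2'.
exists t''; split=> //; first by move=> K; rewrite iterS e e'.
exact: agree_trans a a'.
Qed.

(** The language has no empty program, so the base case clears a register as well. *)
Fixpoint clears k b := if b is b'.+1 then Seq (clears k b') (clear (b' + k)) else clear k.

Lemma runs_clears k b s (Q : store -> Prop) :
  (forall s', agree k s s' -> (forall x, (x < b)%N -> s' (x + k)%N = 0%N) -> Q s') ->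
  runs (clears k b) s Q.
Proof.
elim: b Q => [|b IHb] Q hQ /=.
  by apply: runs_clear; apply: hQ => //; exact: agree_update.
apply: runs_seq; apply: IHb => s' a h; apply: runs_clear; apply: hQ.
  by apply: agree_update => //; lia.
move=> x xb; rewrite updateE; case: eqP => // ne; apply: h; lia.
Qed.

Lemma cf_computable (f : nat -> nat) k F : computable f -> cf k F ->
  cf k (fun s => f (F s)).
Proof.
move=> [p hp] [ext run]; split=> [s s' a|l kl]; first by rewrite (ext _ _ a).
have [q hq] := run _ kl; have [b pb] := regs_belowP p.
(* One more than [b], so that register 0, which carries both input and output, is covered even when
   [b] is 0. *)
have pb' : regs_below b.+1 p by exact: regs_below_le pb.
exists (Seq q (Seq (clears l.+1 b) (shift l p))) => s.
apply: runs_seq; apply: runs_imp (hq s) => s1 [a1 e1].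
apply: runs_seq; apply: runs_clears => s2 a2 h2.
have [i hi fi] := hp (F s).
have h0 x : (x < b.+1)%N -> s2 (x + l)%N = (init p (F s)).2 x.
  case: x => [|x] xb; rewrite /init /= updateE.
    by rewrite eqxx add0n -a2// e1.
  by rewrite addSnnS h2.
have [t' [et' at' ht']] := shift_run hi pb' h0.
exists t' => //; split; last by rewrite -fi -ht'.
apply: agree_trans a1 _; apply: agree_trans at'; apply: agree_le a2; lia.
Qed.

(** [exec] only gives some time at which the stack is empty. The least such time is the halting
    time, and the store no longer changes after it. *)
Lemma runs_halts p n (Q : store -> Prop) : runs p (init p n).2 Q ->
  exists2 l, halts_in p n l & Q (run p n l).2.
Proof.
move=> [s ps Qs]; have [l el] := ps [::].
have hl : exists l, halted (run p n l) by exists l; rewrite /run el.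
case: (ex_minnP hl) => i hi mini; exists i.
  split=> // j; rewrite ltnNge; apply: contra; exact: mini.
have il : (i <= l)%N by apply: mini; rewrite /run el.
have stay j : run p n (i + j)%N = run p n i.
  elim: j => [|j IHj]; first by rewrite addn0.
  rewrite addnS /run iterS -/(run p n _) IHj -/(run p n i); move: hi.
  by rewrite /halted; case: (run p n i) => [[|q k] s'].
by have := stay (l - i)%N; rewrite subnKC// /run el => <-.
Qed.

Lemma cf_computableP (f : nat -> nat) : cf 1 (fun s => f (s 0%N)) -> computable f.
Proof.
move=> [_ /(_ 1%N (leqnn _)) [p hp]]; exists (Seq p (move 1 0)) => n.
apply: (@runs_halts _ _ (fun s => s 0%N = f n)).
apply: runs_seq; apply: runs_imp (hp _) => s [a e].
by apply: runs_move => //; rewrite !updateE /= e.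
Qed.

(** * A universal machine *)

Lemma cf_ext k F G : F =1 G -> cf k F -> cf k G.
Proof. by move=> /funext ->. Qed.

Lemma cf_pred k F : cf k F -> cf k (fun s => (F s).-1).
Proof.
move=> hF; apply: (@cf_ext _ (fun s => iteri (F s) (fun i _ => i) 0%N)).
  by move=> s; case: (F s).
by apply: cf_iteri => //; exact: cf_0.
Qed.

Lemma cf_add k F G : cf k F -> cf k G -> cf k (fun s => (F s + G s)%N).
Proof.
move=> hF hG; apply: (@cf_ext _ (fun s => iteri (G s) (fun _ a => a.+1) (F s))).
  by move=> s; elim: (G s) => [|n /= ->]; rewrite ?addn0 ?addnS.
by apply: cf_iteri => // *; exact: cf_S.
Qed.

Lemma cf_sub k F G : cf k F -> cf k G -> cf k (fun s => (F s - G s)%N).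
Proof.
move=> hF hG; apply: (@cf_ext _ (fun s => iteri (G s) (fun _ a => a.-1) (F s))).
  by move=> s; elim: (G s) => [|n /= ->]; rewrite ?subn0 ?subnS.
by apply: cf_iteri => // *; exact: cf_pred.
Qed.

Lemma cf_mul k F G : cf k F -> cf k G -> cf k (fun s => (F s * G s)%N).
Proof.
move=> hF hG.
apply: (@cf_ext _ (fun s => iteri (G s) (fun _ a => a + F s)%N 0%N)).
  by move=> s; elim: (G s) => [|n /= ->]; rewrite ?muln0 ?mulnS 1?addnC.
by apply: cf_iteri (cf_0 _) _ => // *; apply: cf_add => //; exact: cf_le hF.
Qed.

Lemma cf_exp k F G : cf k F -> cf k G -> cf k (fun s => (F s ^ G s)%N).
Proof.
move=> hF hG.
apply: (@cf_ext _ (fun s => iteri (G s) (fun _ a => a * F s)%N 1%N)).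
  by move=> s; elim: (G s) => [|n /= ->]; rewrite ?expn0 ?expnSr.
by apply: cf_iteri (cf_const _ _) _ => // *; apply: cf_mul => //; exact: cf_le hF.
Qed.

Lemma cf_leq k F G : cf k F -> cf k G -> cf k (fun s => (F s <= G s)%N : nat).
Proof.
move=> hF hG; apply: (@cf_ext _ (fun s => 1 - (F s - G s))%N).
  by move=> s; case: leqP; lia.
by apply: cf_sub (cf_const _ _) _; exact: cf_sub.
Qed.

Lemma cf_andb k (b c : store -> bool) : cf k b -> cf k c ->
  cf k (fun s => b s && c s).
Proof.
move=> hb hc; apply: (@cf_ext _ (fun s => b s * c s)%N); last exact: cf_mul.
by move=> s; case: (b s); case: (c s).
Qed.

Lemma cf_negb k (b : store -> bool) : cf k b -> cf k (fun s => ~~ b s).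
Proof.
move=> hb; apply: (@cf_ext _ (fun s => 1 - b s)%N).
  by move=> s; case: (b s).
exact: cf_sub (cf_const _ _) hb.
Qed.

Lemma cf_eqn k F G : cf k F -> cf k G -> cf k (fun s => F s == G s).
Proof.
move=> hF hG; apply: (@cf_ext _ (fun s => (F s <= G s <= F s)%N)).
  by move=> s; rewrite eqn_leq.
by apply: cf_andb; apply: cf_leq.
Qed.

Lemma cf_if k (b : store -> bool) F G : cf k b -> cf k F -> cf k G ->
  cf k (fun s => if b s then F s else G s).
Proof.
move=> hb hF hG; apply: (@cf_ext _ (fun s => iteri (b s) (fun _ _ => F s) (G s))).
  by move=> s; case: (b s).
by apply: cf_iteri => // *; exact: cf_le hF.
Qed.

Lemma cf_sum k T (F : nat -> store -> nat) : cf k T ->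
  (forall k' I, (k <= k')%N -> cf k' I -> cf k' (fun s => F (I s) s)) ->
  cf k (fun s => \sum_(0 <= i < T s) F i s)%N.
Proof.
move=> hT hF.
apply: (@cf_ext _ (fun s => iteri (T s) (fun i a => a + F i s)%N 0%N)).
  by move=> s; elim: (T s) => [|n /= ->]; rewrite ?big_nil ?big_nat_recr.
apply: cf_iteri (cf_0 _) _ => // k' I X kk' hI hX.
by apply: cf_add => //; exact: hF.
Qed.

Lemma cf_all k T (b : nat -> store -> bool) : cf k T ->
  (forall k' I, (k <= k')%N -> cf k' I -> cf k' (fun s => b (I s) s)) ->
  cf k (fun s => all (b ^~ s) (iota 0 (T s))).
Proof.
move=> hT hb.
apply: (@cf_ext _ (fun s => iteri (T s) (fun i a => a * b i s)%N 1%N)).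
  move=> s; elim: (T s) => [//|n IHn].
  rewrite -[n.+1 in RHS]addn1 iotaD all_cat add0n /= andbT IHn.
  by case: (all _ _); case: (b n s).
apply: cf_iteri (cf_const _ _) _ => // k' I X kk' hI hX.
by apply: cf_mul => //; exact: hb.
Qed.

(** Bounded search by counting: a test that holds exactly below a threshold reveals the threshold as
    the sum of its values. Quotients, heads of lists, halting times and the quarter turn are found
    in this way. *)
Lemma sum_ltn d n : (\sum_(0 <= i < n) (i < d) = minn d n)%N.
Proof.
by elim: n => [|n IHn]; rewrite ?big_nil ?minn0// big_nat_recr //= IHn; lia.
Qed.

Lemma cf_div k F G : cf k F -> cf k G -> cf k (fun s => (F s %/ G s)%N).
Proof.
move=> hF hG; apply: (@cf_ext _ (fun s => if G s == 0%N then 0%N else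
  \sum_(0 <= i < F s) (i.+1 * G s <= F s)%N)%N).
  move=> s; case: eqP => [->|/eqP]; first by rewrite divn0.
  move: (F s) (G s) => x y y0.
  have le i : (i.+1 * y <= x)%N = (i < x %/ y)%N by rewrite leq_divRL ?lt0n.
  under eq_bigr do rewrite le.
  by rewrite sum_ltn; apply/minn_idPl; exact: leq_div.
apply: cf_if; [exact: cf_eqn hG (cf_0 _)|exact: cf_0|].
apply: cf_sum => // k' I kk' hI; apply: cf_leq; last exact: cf_le hF.
by apply: cf_mul; [exact: cf_S|exact: cf_le hG].
Qed.

Lemma cf_max k F G : cf k F -> cf k G -> cf k (fun s => maxn (F s) (G s)).
Proof.
move=> hF hG; apply: (@cf_ext _ (fun s => F s + (G s - F s))%N).
  by move=> s; rewrite maxnE.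
by apply: cf_add => //; exact: cf_sub.
Qed.

(** * Lists coded as numbers *)

Definition hd w := head 0%N (CodeSeq.decode w).
Definition tl w := CodeSeq.code (behead (CodeSeq.decode w)).
Definition ccons x w := (2 ^ x * w.*2.+1)%N.

Lemma cconsE x l : ccons x (CodeSeq.code l) = CodeSeq.code (x :: l).
Proof. by []. Qed.

Lemma hd_code x l : hd (CodeSeq.code (x :: l)) = x.
Proof. by rewrite /hd CodeSeq.codeK. Qed.

Lemma tl_code x l : tl (CodeSeq.code (x :: l)) = CodeSeq.code l.
Proof. by rewrite /tl CodeSeq.codeK. Qed.

Lemma code_cons_eq0 x l : (CodeSeq.code (x :: l) == 0%N) = false.
Proof. by rewrite /CodeSeq.code /= muln_eq0 expn_eq0. Qed.

Lemma hd_nth w : hd w = nth 0%N (CodeSeq.decode w) 0.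
Proof. by rewrite nth0. Qed.

Lemma tlE w : tl w = ((w %/ 2 ^ hd w).-1 %/ 2)%N.
Proof.
rewrite -[w]CodeSeq.decodeK; case: (CodeSeq.decode w) => [|x l].
  by rewrite /tl /hd.
rewrite hd_code tl_code /= mulKn ?expn_gt0//= -muln2 mulnK//.
Qed.

(** The code of [x :: l] is 2^x times an odd number, so the head is the exponent of 2 in [w], that
    is, the number of [i] such that 2^(i+1) divides [w]. *)
Lemma hdE w : hd w = (\sum_(0 <= i < w) (w %/ 2 ^ i.+1 * 2 ^ i.+1 == w))%N.
Proof.
rewrite -[w in LHS]CodeSeq.decodeK.
case e : (CodeSeq.decode w) => [|x l].
  have -> : w = 0%N by rewrite -[w]CodeSeq.decodeK e.
  by rewrite big_nil.
rewrite hd_code; have we : w = ccons x (CodeSeq.code l).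
  by rewrite cconsE -e CodeSeq.decodeK.
have div i : (w %/ 2 ^ i.+1 * 2 ^ i.+1 == w)%N = (i < x)%N.
  have [ix|xi] := ltnP i x.
    by rewrite -dvdn_eq we /ccons dvdn_mulr // dvdn_exp2l.
  apply/negbTE; rewrite -dvdn_eq we /ccons; apply/negP => h.
  have : (2 ^ x.+1 %| 2 ^ x * (CodeSeq.code l).*2.+1)%N.
    by apply: dvdn_trans h; rewrite dvdn_exp2l.
  by rewrite expnSr dvdn_pmul2l ?expn_gt0// dvdn2 /= odd_double.
under eq_bigr do rewrite div.
have xw : (x <= w)%N.
  rewrite we /ccons (leq_trans (ltnW (ltn_expl x (ltnSn 1))))//.
  by rewrite leq_pmulr.
by rewrite sum_ltn; apply/esym/minn_idPl.
Qed.

Lemma cf_hd k F : cf k F -> cf k (fun s => hd (F s)).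
Proof.
move=> hF; apply: (@cf_ext _ (fun s =>
  \sum_(0 <= i < F s) (F s %/ 2 ^ i.+1 * 2 ^ i.+1 == F s))%N).
  by move=> s; rewrite -hdE.
apply: cf_sum => // k' I kk' hI; have hF' := cf_le kk' hF.
have h2 : cf k' (fun s => 2 ^ (I s).+1)%N.
  by apply: cf_exp (cf_const _ _) _; exact: cf_S.
by apply: cf_eqn => //; apply: cf_mul => //; exact: cf_div.
Qed.

Lemma cf_tl k F : cf k F -> cf k (fun s => tl (F s)).
Proof.
move=> hF; apply: (@cf_ext _ (fun s => (F s %/ 2 ^ hd (F s)).-1 %/ 2)%N).
  by move=> s; rewrite -tlE.
apply: cf_div (cf_const _ _); apply: cf_pred; apply: cf_div => //.
by apply: cf_exp (cf_const _ _) _; exact: cf_hd.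
Qed.

Lemma cf_ccons k F G : cf k F -> cf k G -> cf k (fun s => ccons (F s) (G s)).
Proof.
move=> hF hG; apply: (@cf_ext _ (fun s => 2 ^ F s * (2 * G s).+1)%N).
  by move=> s; rewrite /ccons mul2n.
apply: cf_mul; first exact: cf_exp (cf_const _ _) _.
by apply: cf_S; apply: cf_mul (cf_const _ _) _.
Qed.

Definition cnth w i := nth 0%N (CodeSeq.decode w) i.

Lemma cf_cnth k F G : cf k F -> cf k G -> cf k (fun s => cnth (F s) (G s)).
Proof.
move=> hF hG; apply: (@cf_ext _ (fun s => hd (iteri (G s) (fun _ w => tl w) (F s)))).
  move=> s; rewrite hd_nth /cnth.
  suff -> : forall n, iteri n (fun _ w => tl w) (F s) =
      CodeSeq.code (drop n (CodeSeq.decode (F s))).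
    by rewrite CodeSeq.codeK nth_drop addn0.
  elim=> [|n IHn]; first by rewrite drop0 CodeSeq.decodeK.
  by rewrite /= IHn /tl CodeSeq.codeK -drop1 drop_drop add1n.
by apply: cf_hd; apply: cf_iteri => // *; exact: cf_tl.
Qed.

(** The patterns [@?F s] recover each argument as a function of the store. Constants are recognised
    before the arithmetic rules, so that a closed number is not taken apart. *)
Ltac cf_step := cbv beta zeta;
  match goal with
  | h : cf ?k ?F |- cf ?k ?F => exact: h
  | h : cf ?k ?F |- cf ?k' ?F => apply: (cf_le _ h); lia
  | |- cf ?k (fun _ => ?c) => exact: (@cf_const k c)
  | h : computable ?f |- cf ?k (fun s => ?f (@?F s)) =>
      apply: (@cf_computable f k F h)
  | |- cf ?k (fun s => ccons (@?F s) (@?G s)) => apply: (@cf_ccons k F G)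
  | |- cf ?k (fun s => cnth (@?F s) (@?G s)) => apply: (@cf_cnth k F G)
  | |- cf ?k (fun s => hd (@?F s)) => apply: (@cf_hd k F)
  | |- cf ?k (fun s => tl (@?F s)) => apply: (@cf_tl k F)
  | |- cf ?k (fun s => if _ then _ else _) => apply: cf_if
  | |- cf ?k (fun s => nat_of_bool (@?F s && @?G s)) => apply: (@cf_andb k F G)
  | |- cf ?k (fun s => nat_of_bool (~~ @?F s)) => apply: (@cf_negb k F)
  | |- cf ?k (fun s => nat_of_bool (_ == _)) => apply: cf_eqn
  | |- cf ?k (fun s => nat_of_bool (@?F s <= @?G s)%N) => apply: (@cf_leq k F G)
  | |- cf ?k (fun s => nat_of_bool (all (@?b s) (iota 0 (@?T s)))) =>
      apply: (@cf_all k T (fun i s => b s i)); [|move=> ? ? ? ?]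
  | |- cf ?k (fun s => (@?F s).+1) => apply: (@cf_S k F)
  | |- cf ?k (fun s => (@?F s).-1) => apply: (@cf_pred k F)
  | |- cf ?k (fun s => (@?F s + @?G s)%N) => apply: (@cf_add k F G)
  | |- cf ?k (fun s => (@?F s - @?G s)%N) => apply: (@cf_sub k F G)
  | |- cf ?k (fun s => (@?F s * @?G s)%N) => apply: (@cf_mul k F G)
  | |- cf ?k (fun s => (@?F s ^ @?G s)%N) => apply: (@cf_exp k F G)
  | |- cf ?k (fun s => (@?F s %/ @?G s)%N) => apply: (@cf_div k F G)
  | |- cf ?k (fun s => maxn (@?F s) (@?G s)) => apply: (@cf_max k F G)
  | |- cf ?k (fun s => iteri _ _ _) => apply: cf_iteri; [| |move=> ? ? ? ? ? ?]
  end.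
Ltac cf_auto := repeat cf_step.

(** The list is rebuilt from its last entry. Since a list coded by [w] has at most [w] entries,
    [w + x + 1] entries are enough, and the padding by zeros is invisible to [cnth]. *)
Definition cupd w x v :=
  iteri (w + x).+1 (fun i acc => let j := (w + x - i)%N in
    ccons (if j == x then v else cnth w j) acc) 0%N.

Lemma cf_cupd k F G H : cf k F -> cf k G -> cf k H ->
  cf k (fun s => cupd (F s) (G s) (H s)).
Proof. move=> hF hG hH; rewrite /cupd; cf_auto. Qed.

Lemma size_decode w : (size (CodeSeq.decode w) <= w)%N.
Proof.
rewrite -{2}[w]CodeSeq.decodeK; elim: (CodeSeq.decode w) => //= x l IHl.
have := expn_gt0 2 x; nia.
Qed.

Lemma cnth_cupd w x v y :
  cnth (cupd w x v) y = if y == x then v else cnth w y.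
Proof.
have dE n : (n <= (w + x).+1)%N ->
    CodeSeq.decode (iteri n (fun i acc => let j := (w + x - i)%N in
      ccons (if j == x then v else cnth w j) acc) 0%N) =
    [seq if j == x then v else cnth w j | j <- iota ((w + x).+1 - n) n].
  elim: n => [//|n IHn] nw; rewrite [iteri _ _ _]/=.
  rewrite -[iteri n _ _]CodeSeq.decodeK cconsE CodeSeq.codeK IHn; last by lia.
  by rewrite subSS subSn //.
rewrite /cnth /cupd dE// subnn.
have [ylt|yge] := ltnP y (w + x).+1.
  by rewrite (nth_map 0%N) ?size_iota// nth_iota.
rewrite nth_default ?size_map ?size_iota// ifN; last by lia.
by rewrite nth_default// (leq_trans (size_decode w)); lia.
Qed.

(* A configuration is coded by the pair of the code of its stack of programs and
   of the code of a finite sequence of registers, the others being [0]. *)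
Definition cstep c :=
  let K := hd c in let w := hd (tl c) in
  let p := hd K in let K' := tl K in
  let x := hd (tl p) in let y := hd (tl (tl p)) in
  if K == 0%N then c else
  if hd p == 0%N then ccons K' (ccons (cupd w x (cnth w x).+1) 0) else
  if hd p == 1%N then ccons K' (ccons (cupd w x (cnth w x).-1) 0) else
  if hd p == 2 then ccons (ccons x (ccons y K')) (ccons w 0) else
  if cnth w x == 0%N then ccons K' (ccons w 0) else ccons (ccons y K) (ccons w 0).

Lemma cf_cstep k F : cf k F -> cf k (fun s => cstep (F s)).
Proof.
move=> hF; rewrite /cstep /=.
by repeat first [apply: cf_cupd | cf_step].
Qed.

#[local] Arguments CodeSeq.code : simpl never.

Definition represents c (cfg : config) :=
  exists w, c = CodeSeq.code [:: CodeSeq.code (map prog_code cfg.1); w] /\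
    cfg.2 = cnth w.

Lemma hd_prog p : hd (prog_code p) = match p with
  | Inc _ => 0%N | Dec _ => 1%N | Seq _ _ => 2 | While _ _ => 3 end.
Proof. by case: p => *; rewrite /prog_code hd_code. Qed.

Lemma represents_step c cfg : represents c cfg -> represents (cstep c) (step cfg).
Proof.
move: cfg => [ks s] [w [-> e]]; rewrite [s]e {s e} [(_, _).1]/=.
rewrite /cstep hd_code tl_code hd_code.
case: ks => [|q ks]; first by exists w.
rewrite map_cons code_cons_eq0 hd_code tl_code hd_prog.
case: q => [x|x|p q|x p] /=; rewrite ?tl_code ?hd_code ?tl_code ?hd_code.
- exists (cupd w x (cnth w x).+1); split=> //=.
  by apply/funext => y; rewrite cnth_cupd updateE.
- exists (cupd w x (cnth w x).-1); split=> //=.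
  by apply/funext => y; rewrite cnth_cupd updateE.
- by exists w.
- by case: ifP => _; exists w.
Qed.

Definition crun e l := iteri l (fun _ c => cstep c) (ccons (ccons e 0) (ccons 0 0)).

Lemma cf_crun k F G : cf k F -> cf k G -> cf k (fun s => crun (F s) (G s)).
Proof.
move=> hF hG; rewrite /crun; apply: cf_iteri => //; first by cf_auto.
by move=> *; exact: cf_cstep.
Qed.

Lemma crunP p l : represents (crun (prog_code p) l) (run p 0 l).
Proof.
elim: l => [|l IHl].
  exists 0%N; split=> //; apply/funext => y; rewrite /= updateE /cnth nth_nil.
  by case: ifP.
by rewrite /run iterS; exact: represents_step.
Qed.

Lemma crun_halted p l : (hd (crun (prog_code p) l) == 0%N) = halted (run p 0 l).
Proof.
have [w [-> _]] := crunP p l; rewrite hd_code /halted.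
by case: (run p 0 l).1 => [|q k]; rewrite ?map_cons ?code_cons_eq0.
Qed.

(** Counting the times before [J] at which the machine still runs gives min(l, J) if it halts in [l]
    steps and [J] if it never halts: a total substitute for the halting time. *)
Definition cutoff e J := (\sum_(0 <= i < J) (hd (crun e i) != 0%N))%N.

Lemma cf_cutoff k F G : cf k F -> cf k G -> cf k (fun s => cutoff (F s) (G s)).
Proof.
move=> hF hG; rewrite /cutoff; apply: cf_sum => // k' I kk' hI.
apply: cf_negb; apply: cf_eqn; last exact: cf_0.
apply: cf_hd; apply: cf_crun; cf_auto.
Qed.

Lemma cutoff_le e J : (cutoff e J <= J)%N.
Proof.
rewrite /cutoff; elim: J => [|J IHJ]; first by rewrite big_nil.
by rewrite big_nat_recr //= -addn1 leq_add// leq_b1.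
Qed.

Lemma halted_mono p n i j : (i <= j)%N -> halted (run p n i) -> halted (run p n j).
Proof.
move=> /subnK <-; elim: (j - i)%N => [|d IHd] hi; [exact: hi|have := IHd hi].
by rewrite /run addSn iterS -/(run p n _) /halted; case: (run p n _) => [[|q k] s'].
Qed.

Lemma cutoff_halts p l J : halts_in_exactly p l -> cutoff (prog_code p) J = minn l J.
Proof.
move=> [hl hlt]; rewrite /cutoff.
have hE i : halted (run p 0 i) = (l <= i)%N.
  apply/idP/idP => [hi|li]; last exact: halted_mono hl.
  by rewrite leqNgt; apply/negP => /hlt; rewrite hi.
under eq_bigr do rewrite crun_halted hE -ltnNge.
exact: sum_ltn.
Qed.

Lemma cutoff_diverges p J : (forall l, ~ halts_in_exactly p l) ->
  cutoff (prog_code p) J = J.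
Proof.
move=> hp; rewrite /cutoff -[RHS]subn0 -[RHS]muln1 -sum_nat_const_nat.
apply: eq_bigr => i _.
rewrite crun_halted; case: (boolP (halted _)) => // hi.
have hl : exists l, halted (run p 0 l) by exists i.
case: (ex_minnP hl) => l hl' mini; exfalso; apply: (hp l); split=> // j.
by rewrite ltnNge; apply: contra; exact: mini.
Qed.

Local Open Scope ring_scope.

(** * The metric of the sphere *)

Section Geometry.
Variable R : realType.
Implicit Types a b c d x y t : R.

Lemma sin_MVT x : 0 <= x -> exists2 c, 0 <= c <= x & sin x = cos c * x.
Proof.
move=> x0; have := @MVT_segment R (@sin R) (@cos R) _ _ x0.
case=> [|c].
  by apply: continuous_subspaceT => y; exact: continuous_sin.
by rewrite in_itv/= sin0 !subr0 => ? ?; exists c.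
Qed.

Lemma sin_le_id x : 0 <= x -> sin x <= x.
Proof. by move=> x0; have [c _ ->] := sin_MVT x0; rewrite ler_piMl// cos_le1. Qed.

Lemma sqr_sin_le x : sin x ^+ 2 <= x ^+ 2.
Proof.
wlog x0 : x / 0 <= x.
  move=> h; have [/h//|/ltW x0] := leP 0 x.
  by rewrite -[x ^+ 2]sqrrN -[sin x ^+ 2]sqrrN -sinN; apply: h; rewrite oppr_ge0.
rewrite !expr2; have [s0|s0] := leP 0 (sin x).
  by apply: ler_pM => //; exact: sin_le_id.
have := sin_le_id x0; have := sin_geN1 x; have [x1|x1] := leP 1 x; first by nra.
move=> _ _; have : 0 <= sin x by apply: sin_ge0_pi; have := pi_ge2 R; lra.
by rewrite leNgt s0.
Qed.

Lemma oneBcos_sin x : 1 - cos x = 2 * sin (x / 2) ^+ 2.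
Proof.
have -> : cos x = cos ((x / 2) *+ 2) by congr cos; rewrite -mulr_natr; field.
by rewrite cos_mulr2n cos2sin2 -mulr_natr; ring.
Qed.

Lemma oneBcos_le x : 1 - cos x <= x ^+ 2 / 2.
Proof. by rewrite oneBcos_sin; have := sqr_sin_le (x / 2); nra. Qed.

Lemma cos1_ge : 1 / 2 <= cos 1 :> R.
Proof. by have := oneBcos_le 1; lra. Qed.

(** On [0, 1] the mean value theorem and cos >= 1/2 give sin x >= x/2; beyond 1, sin x >= sin 1 >=
    1/2 >= x/4 because pi/2 < 2. *)
Lemma sin_ge_quarter x : 0 <= x <= pi / 2 -> x / 4 <= sin x.
Proof.
have half y : 0 <= y <= 1 -> y / 2 <= sin y.
  move=> /andP[y0 y1]; have [c /andP[c0 cy] ->] := sin_MVT y0.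
  rewrite mulrC ler_wpM2r//; have := cos1_ge; suff : cos 1 <= cos c by lra.
  rewrite leNgt ltr_cos -?leNgt ?in_itv/=; have := pi_ge2 R; lra.
move=> /andP[x0 xpi]; have [x1|x1] := leP x 1; first by have := half x; lra.
have := half 1; have := pihalf_lt2 R; suff : sin 1 <= sin x by lra.
by rewrite leNgt ltr_sin -?leNgt ?in_itv/=; have := pihalf_ge1 R; lra.
Qed.

(** For theta = acos d, 1 - d = 2 sin(theta/2)^2 >= 2 (theta/8)^2 = theta^2 / 32. Geodesic distances
    are thereby bounded by rational expressions in the coordinates. *)
Lemma acos_sqr_le d : -1 <= d <= 1 -> acos d ^+ 2 <= 32 * (1 - d).
Proof.
move=> d1; have a0 := acos_ge0 d1; have api := acos_lepi d1.
have -> : 1 - d = 1 - cos (acos d) by rewrite acosK ?in_itv.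
rewrite oneBcos_sin; set y := acos d / 2.
have -> : acos d = 2 * y by rewrite /y; field.
have y0 : 0 <= y by rewrite /y; lra.
have := @sin_ge_quarter y; rewrite y0 => h.
have : y / 4 <= sin y by apply: h; rewrite /y; lra.
by move: (sin y) => u; nra.
Qed.

Definition pt a b : sphere R := Some (a +i* b)%C.

Lemma dot3_bound (x y : sphere R) : -1 <= dot3 (stereo x) (stereo y) <= 1.
Proof.
have := dot3_stereoxx x; have := dot3_stereoxx y.
move: (stereo x) (stereo y) => u v; rewrite /dot3 => v1 u1.
have := sqr_ge0 (u.1.1 - v.1.1); have := sqr_ge0 (u.1.2 - v.1.2).
have := sqr_ge0 (u.2 - v.2); have := sqr_ge0 (u.1.1 + v.1.1).
have := sqr_ge0 (u.1.2 + v.1.2); have := sqr_ge0 (u.2 + v.2).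
by move=> *; apply/andP; split; nra.
Qed.

Lemma mdistE (x y : sphere R) : mdist x y = acos (dot3 (stereo x) (stereo y)).
Proof. by []. Qed.

Lemma mdist_le_chord (x y : sphere R) b : 0 <= b ->
  32 * (1 - dot3 (stereo x) (stereo y)) <= b ^+ 2 -> mdist x y <= b.
Proof.
move=> b0 h; have := acos_sqr_le (dot3_bound x y); rewrite -mdistE => h'.
rewrite -(@ler_pXn2r _ 2%N)// ?nnegrE ?mdist_ge0//; exact: le_trans h.
Qed.

(** Here 1 - dot3 is 2 |z - w|^2 / ((1 + |z|^2) (1 + |w|^2)), whose denominator is at least 1, and 8
    is the square root of 32 * 2. *)
Lemma mdist_pt a b c d : mdist (pt a b) (pt c d) <= 8 * (`|a - c| + `|b - d|).
Proof.
apply: mdist_le_chord; first by rewrite mulr_ge0// addr_ge0.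
have -> : 1 - dot3 (stereo (pt a b)) (stereo (pt c d)) =
   2 * ((a - c) ^+ 2 + (b - d) ^+ 2) / ((a ^+ 2 + b ^+ 2 + 1) * (c ^+ 2 + d ^+ 2 + 1)).
  rewrite /dot3/=; field.
  by rewrite !gt_eqF//; nra.
rewrite mulrA ler_pdivrMr; last by apply: mulr_gt0; nra.
rewrite -(real_normK (num_real (a - c))) -(real_normK (num_real (b - d))).
have := normr_ge0 (a - c); have := normr_ge0 (b - d).
move: `|a - c| `|b - d| => u v v0 u0.
have A : 1 <= (a ^+ 2 + b ^+ 2 + 1) * (c ^+ 2 + d ^+ 2 + 1).
  have := sqr_ge0 a; have := sqr_ge0 b; have := sqr_ge0 c; have := sqr_ge0 d.
  by nra.
have B : 32 * (2 * (u ^+ 2 + v ^+ 2)) <= (8 * (u + v)) ^+ 2 by nra.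
apply: (le_trans B); rewrite ler_peMr// sqr_ge0//.
Qed.

Lemma mdist_inf a b r : 0 < r -> r ^+ 2 <= a ^+ 2 + b ^+ 2 ->
  mdist (pt a b) None <= 8 / r.
Proof.
move=> r0 rab; apply: mdist_le_chord; first by rewrite divr_ge0// ltW.
have q0 : 0 < a ^+ 2 + b ^+ 2 + 1 by have := sqr_ge0 a; have := sqr_ge0 b; lra.
have -> : 1 - dot3 (stereo (pt a b)) (stereo (None : sphere R)) =
   2 / (a ^+ 2 + b ^+ 2 + 1).
  by rewrite /dot3/=; field; rewrite gt_eqF.
rewrite mulrA expr_div_n ler_pdivrMr// mulrAC ler_pdivlMr ?exprn_gt0//.
by nra.
Qed.

(** The unit circle is the equator, a great circle: geodesic distance along it is the angle, folded
    to at most pi. *)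
Lemma mdist_circle x y : mdist (pt (cos x) (sin x)) (pt (cos y) (sin y)) <= `|x - y|.
Proof.
rewrite mdistE.
have -> : dot3 (stereo (pt (cos x) (sin x))) (stereo (pt (cos y) (sin y))) =
    cos `|x - y|.
  rewrite /dot3/= !cos2Dsin2 cos_norm cosB; by field.
have [h|h] := leP `|x - y| pi; first by rewrite cosK// in_itv/= normr_ge0.
by apply: le_trans (acos_lepi _) (ltW h); rewrite cos_geN1 cos_le1.
Qed.

Lemma cos_lip x y : `|cos x - cos y| <= `|x - y|.
Proof.
have h : (cos x - cos y) ^+ 2 <= (x - y) ^+ 2.
  apply: le_trans (_ : 2 * (1 - cos (x - y)) <= _); last first.
    by have := oneBcos_le (x - y); lra.
  rewrite cosB; have := cos2Dsin2 x; have := cos2Dsin2 y.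
  by have := sqr_ge0 (sin x - sin y); nra.
by rewrite -(@ler_pXn2r _ 2%N)// ?nnegrE// !real_normK ?num_real.
Qed.

Lemma sin_lip x y : `|sin x - sin y| <= `|x - y|.
Proof.
by have := cos_lip (x - pi / 2) (y - pi / 2); rewrite !cosBpihalf opprB addrA subrK.
Qed.
End Geometry.

(** * Rational points of the circle *)

(* [(C, S)] such that [C + i S = (M^2 - 1 + 2 i M)^q], as long as this stays in
   the first quadrant; afterwards [C] is stuck at [0] by truncated subtraction. *)
Definition cpow M q := iteri q (fun _ w =>
  ccons ((M ^ 2 - 1) * hd w - 2 * M * hd (tl w))%N
  (ccons (2 * M * hd w + (M ^ 2 - 1) * hd (tl w))%N 0)) (ccons 1 (ccons 0 0)).

Definition ccos M q := hd (cpow M q).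
Definition csin M q := hd (tl (cpow M q)).
(** Each step turns by at least 1/M and pi/2 < 2, so the quarter turn is completed within 2 M steps.
    [cindex] then counts a full turn as four quarters. *)
Definition cquarter M := (\sum_(0 <= p < (2 * M).+1) (0 < ccos M p)%N)%N.
Definition cindex M E D := ((4 * cquarter M * D) %/ 2 ^ E)%N.

Lemma ccons_code1 x : ccons x 0 = CodeSeq.code [:: x].
Proof. by []. Qed.

Lemma ccosS M q :
  ccos M q.+1 = ((M ^ 2 - 1) * ccos M q - 2 * M * csin M q)%N.
Proof. by rewrite /ccos /= ccons_code1 cconsE hd_code. Qed.

Lemma csinS M q :
  csin M q.+1 = (2 * M * ccos M q + (M ^ 2 - 1) * csin M q)%N.
Proof. by rewrite /csin /= ccons_code1 cconsE tl_code hd_code. Qed.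

Lemma ccos0 M : ccos M 0 = 1%N.
Proof. by rewrite /ccos /= ccons_code1 cconsE hd_code. Qed.

Lemma csin0 M : csin M 0 = 0%N.
Proof. by rewrite /csin /= ccons_code1 cconsE tl_code hd_code. Qed.

Section Approximation.
Variable R : realType.

Section Rotation.
Variable M : nat.
Hypothesis M0 : (0 < M)%N.
Variable m : R.
Hypothesis mE : M%:R = m.
Let m1 : 1 <= m. Proof. by rewrite -mE ler1n. Qed.
Let X : R := m ^+ 2 + 1.
Let X0 : 0 < X. Proof. by rewrite /X; have := m1; nra. Qed.
Let c : R := (m ^+ 2 - 1) / X.
Let c1 : -1 <= c <= 1.
Proof. by have m1' := m1; rewrite /c ler_pdivlMr// ler_pdivrMr// /X; apply/andP; split; nra. Qed.
Let th : R := acos c.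
Let costh : cos th = c. Proof. by rewrite /th acosK// in_itv. Qed.
Let sinth : sin th = 2 * m / X.
Proof.
rewrite /th sin_acos//; have -> : 1 - c ^+ 2 = (2 * m / X) ^+ 2.
  by rewrite /c /X; field; rewrite gt_eqF.
have m0 : 0 <= 2 * m by have := m1; lra.
by rewrite sqrtr_sqr ger0_norm// divr_ge0 ?(ltW X0)//.
Qed.
Let th_ge0 : 0 <= th. Proof. exact: acos_ge0. Qed.

Let th_ge : 1 <= m * th.
Proof.
have m1' := m1; have := sin_le_id th_ge0; rewrite sinth ler_pdivrMr// /X => h.
have h' : 0 <= th * (m ^+ 2 - 1) by apply: mulr_ge0 th_ge0 _; nra.
have m0 : 0 < 2 * m by lra.
by rewrite -(ler_pM2r m0) mul1r; nra.
Qed.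

Let th_le : th <= 8 / m.
Proof.
have m1' := m1; rewrite -(@ler_pXn2r _ 2%N) ?nnegrE//; last by apply: divr_ge0 => //; lra.
apply: le_trans (acos_sqr_le c1) _.
have -> : 1 - c = 2 / X by rewrite /c /X; field; rewrite gt_eqF.
rewrite expr_div_n ler_pdivlMr ?exprn_gt0//; last by lra.
have -> : 32 * (2 / X) * m ^+ 2 = 64 * m ^+ 2 / X by field; rewrite gt_eqF.
by rewrite ler_pdivrMr// /X; nra.
Qed.

Let alphaE : (M ^ 2 - 1)%N%:R = m ^+ 2 - 1 :> R.
Proof. by rewrite natrB ?natrX ?mE// expn_gt0 M0. Qed.

Let step_cos q : cos (q.+1%:R * th) =
  ((m ^+ 2 - 1) * cos (q%:R * th) - 2 * m * sin (q%:R * th)) / X.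
Proof.
rewrite -natr1 mulrDl mul1r cosD costh sinth /c; field.
by rewrite gt_eqF.
Qed.

Let step_sin q : sin (q.+1%:R * th) =
  (2 * m * cos (q%:R * th) + (m ^+ 2 - 1) * sin (q%:R * th)) / X.
Proof.
rewrite -natr1 mulrDl mul1r sinD costh sinth /c; field.
by rewrite gt_eqF.
Qed.

Let exact_pow q : q%:R * th <= pi / 2 ->
  (ccos M q)%:R = X ^+ q * cos (q%:R * th) /\
  (csin M q)%:R = X ^+ q * sin (q%:R * th).
Proof.
elim: q => [_|q IHq hq]; first by rewrite ccos0 csin0 !mul0r cos0 sin0 !expr0 !mul1r.
have le : q%:R * th <= q.+1%:R * th by rewrite ler_wpM2r// ler_nat.
have [eC eS] := IHq (le_trans le hq).
have q0 : 0 <= q.+1%:R * th by rewrite mulr_ge0.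
have cge : 0 <= cos (q.+1%:R * th).
  by apply: cos_ge0_pihalf; rewrite hq andbT; have := pi_ge2 R; lra.
have cE : (m ^+ 2 - 1) * (ccos M q)%:R - 2 * m * (csin M q)%:R =
    X ^+ q.+1 * cos (q.+1%:R * th).
  by rewrite eC eS step_cos (exprS X); field; rewrite gt_eqF.
have sE : 2 * m * (ccos M q)%:R + (m ^+ 2 - 1) * (csin M q)%:R =
    X ^+ q.+1 * sin (q.+1%:R * th).
  by rewrite eC eS step_sin (exprS X); field; rewrite gt_eqF.
rewrite ccosS csinS natrD !natrM alphaE mE sE; split=> //.
rewrite natrB ?natrM ?alphaE ?mE// -(@ler_nat R) !natrM alphaE mE -subr_ge0 cE.
by rewrite mulr_ge0// exprn_ge0// ltW.
Qed.

(** As th <= pi, the step that crosses pi/2 reaches an angle of at most 3 pi/2, where the cosine is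
    nonpositive and is truncated to 0; from then on nothing positive is left to subtract from. *)
Let stuck q : pi / 2 <= q%:R * th -> ccos M q = 0%N.
Proof.
elim: q => [|q IHq]; first by rewrite mul0r => h; exfalso; have := pi_ge2 R; lra.
move=> hq; have [/IHq e|lt] := leP (pi / 2) (q%:R * th).
  by rewrite ccosS e muln0 sub0n.
have [eC eS] := exact_pow (ltW lt).
rewrite ccosS; apply/eqP; rewrite subn_eq0 -(@ler_nat R) !natrM alphaE mE -subr_le0.
have -> : (m ^+ 2 - 1) * (ccos M q)%:R - 2 * m * (csin M q)%:R =
    X ^+ q.+1 * cos (q.+1%:R * th).
  by rewrite eC eS step_cos (exprS X); field; rewrite gt_eqF.
rewrite pmulr_rle0 ?exprn_gt0//.
have -> : cos (q.+1%:R * th) = - cos (q.+1%:R * th - pi).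
  by rewrite -[in LHS](subrK pi (q.+1%:R * th)) cosDpi.
rewrite oppr_le0; apply: cos_ge0_pihalf.
have thpi : th <= pi by exact: acos_lepi.
have e : q.+1%:R * th = q%:R * th + th by rewrite -natr1; ring.
by move: lt hq; rewrite e; have := pi_ge2 R; lra.
Qed.

(** If P steps make a quarter turn, then 4 P th exceeds 2 pi by at most 4 th. Since t = D / 2^E <
    1/4, this excess costs at most th from above, and rounding 4 P t down costs at most th from
    below; th <= 8/m. The bound on t also keeps the index below P, where [exact_pow] applies. *)
Lemma circle_approx E D : (4 * D < 2 ^ E)%N -> exists a : R,
  [/\ (ccos M (cindex M E D))%:R = X ^+ cindex M E D * cos a,
      (csin M (cindex M E D))%:R = X ^+ cindex M E D * sin a &
      `|a - 2 * pi * (D%:R / 2 ^+ E)| <= 8 / m].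
Proof.
move=> DE; have th0 := th_ge0; have ex : exists p, pi / 2 <= p%:R * th.
  by exists (2 * M)%N; rewrite natrM; have := pihalf_lt2 R; have := th_ge; rewrite mE; nra.
case: (ex_minnP ex) => P hP minP.
have P2M : (P <= 2 * M)%N.
  by apply: minP; rewrite natrM; have := pihalf_lt2 R; have := th_ge; rewrite mE; nra.
have lt p : (p < P)%N -> p%:R * th < pi / 2.
  by rewrite ltNge => pP; apply/negP => /minP; rewrite leqNgt pP.
have PE : cquarter M = P.
  rewrite /cquarter; transitivity (\sum_(0 <= p < (2 * M).+1) (p < P))%N.
    apply: eq_bigr => p _; congr nat_of_bool; have [pP|Pp] := ltnP p P.
      have [e _] := exact_pow (ltW (lt _ pP)).
      rewrite -(@ltr_nat R) e mulr_gt0 ?exprn_gt0//.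
      by apply: cos_gt0_pihalf; rewrite lt// andbT (lt_le_trans _ (mulr_ge0 _ _))//;
        have := pi_ge2 R; lra.
    rewrite stuck// (le_trans hP)// ler_wpM2r// ler_nat//.
  by rewrite sum_ltn; lia.
have P0 : (0 < P)%N.
  by rewrite lt0n; apply/eqP => P0; move: hP; rewrite P0 mul0r; have := pi_ge2 R; lra.
set q := cindex M E D; have qP : (q < P)%N.
  by rewrite /q /cindex PE ltn_divLR ?expn_gt0//; nia.
have [eC eS] := exact_pow (ltW (lt _ qP)).
exists (q%:R * th); split=> //; apply: le_trans th_le.
have E0 : 0 < 2 ^+ E :> R by rewrite exprn_gt0.
set t := D%:R / 2 ^+ E.
have t0 : 0 <= t by rewrite divr_ge0// ltW.
have t1 : 4 * t <= 1.
  by rewrite /t mulrA ler_pdivrMr// mul1r -natrX -natrM ler_nat ltnW.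
have q1 : q%:R <= 4 * P%:R * t.
  rewrite /t mulrA ler_pdivlMr// -natrX -!natrM ler_nat /q /cindex PE.
  exact: leq_trunc_div.
have q2 : 4 * P%:R * t <= q%:R + 1.
  rewrite /t mulrA ler_pdivrMr// -natrX natr1 -!natrM ler_nat /q /cindex PE.
  by apply/ltnW; rewrite -ltn_divLR ?expn_gt0.
have hP' : P%:R * th <= pi / 2 + th.
  move: (lt P.-1); rewrite ltn_predL => /(_ P0) h.
  have -> : P%:R = P.-1%:R + 1 :> R by rewrite natr1 prednK.
  by rewrite mulrDl mul1r lerD2r ltW.
rewrite ler_norml; apply/andP; split.
- have : (4 * P%:R * t - 1) * th <= q%:R * th by rewrite ler_wpM2r//; lra.
  have : 4 * t * (pi / 2) <= 4 * t * (P%:R * th) by rewrite ler_wpM2l//; lra.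
  by move: (P%:R * th) (q%:R * th) => u v; nra.
- have : q%:R * th <= 4 * P%:R * t * th by rewrite ler_wpM2r//; lra.
  have : 4 * t * (P%:R * th) <= 4 * t * (pi / 2 + th) by rewrite ler_wpM2l//; lra.
  have : 4 * t * th <= th by rewrite ler_piMl.
  by move: (P%:R * th) (q%:R * th) => u v; nra.
Qed.

End Rotation.

Lemma bernoulli (r : R) n : 0 <= r -> 1 - n%:R * (1 - r) <= r ^+ n.
Proof.
move=> r0; elim: n => [|n IHn]; first by rewrite mul0r subr0.
rewrite exprS -natr1; have := ler_wpM2l r0 IHn.
have := mulr_ge0 (ler0n R n) (sqr_ge0 (1 - r)).
by move: (r ^+ n) (n%:R) => u k; lra.
Qed.

(** With r = Q/(Q+1), the inequality 1 + x <= exp x gives r^(Q+1) <= 1/e <= r^Q. The two bounds on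
    exp(-y) differ by the factor r^y, which is at least 1 - y/(Q+1) by Bernoulli. *)
Lemma expN_approx (Q y : nat) : (0 < Q)%N ->
  expR (- y%:R) <= (Q%:R / Q.+1%:R : R) ^+ (Q * y) <=
    expR (- y%:R) + y%:R / Q.+1%:R.
Proof.
move=> Q0; set v := _ ^+ (Q * y); set r : R := Q%:R / Q.+1%:R.
have Q0' : 0 < Q%:R :> R by rewrite ltr0n.
have r0 : 0 <= r by rewrite divr_ge0.
have rE : r = 1 - Q.+1%:R^-1 by rewrite /r -natr1; field; lra.
have r1 : r <= 1 by rewrite rE lerBlDr lerDl invr_ge0.
apply/andP; split.
- have -> : - y%:R = (Q * y)%:R * (- Q%:R^-1) :> R.
    by rewrite natrM; field; rewrite gt_eqF.
  rewrite expRM_natl /v; apply: lerXn2r; rewrite ?nnegrE ?expR_ge0//.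
  rewrite expRN /r -[_ / _]invrK lef_pV2 ?posrE ?expR_gt0 ?invr_gt0 ?divr_gt0//.
  have -> : (Q%:R / Q.+1%:R)^-1 = 1 + Q%:R^-1 :> R.
    by rewrite -natr1; field; rewrite !gt_eqF//; lra.
  exact: expR_ge1Dx.
- have bern : 1 - y%:R * (1 - r) <= r ^+ y.
    exact: bernoulli.
  have low : r ^+ (Q.+1 * y) <= expR (- y%:R).
    have -> : - y%:R = (Q.+1 * y)%:R * (- Q.+1%:R^-1) :> R.
      by rewrite natrM -natr1; field; rewrite gt_eqF//; lra.
    rewrite expRM_natl; apply: lerXn2r; rewrite ?nnegrE ?expR_ge0//.
    by rewrite rE expR_ge1Dx.
  have -> : y%:R / Q.+1%:R = y%:R * (1 - r) by rewrite rE opprB addrCA subrr addr0.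
  have v1 : v <= 1 by rewrite /v exprn_ile1.
  have v0 : 0 <= v by rewrite /v exprn_ge0.
  have k0 : 0 <= y%:R * (1 - r) by rewrite mulr_ge0// subr_ge0.
  have vr : v * r ^+ y <= expR (- y%:R) by rewrite /v -exprD -mulSnr.
  have h1 := ler_wpM2l v0 bern; have h2 := ler_wpM2r k0 v1.
  move: h1 h2 vr; move: (r ^+ y) (y%:R * (1 - r)) (expR _) => u k ex; lra.
Qed.
End Approximation.

(** * The complement of Omega *)

Lemma halts_in_inj p n l l' : halts_in p n l -> halts_in p n l' -> l = l'.
Proof.
move=> [h m] [h' m']; case: (ltngtP l l') => [/m'|/m|//].
  by rewrite h.
by rewrite h'.
Qed.

Section Complement.
Variable R : realType.
Implicit Types x y t : R.

Definition arc_start n j k : R := 2 ^- n - 2 ^- (2 * n) + k%:R * 2 ^- (2 * n + j).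
Definition arc_length n j : R := expR (- 2 ^+ (2 * n + 2 * j)).

(* The index [k] here is [2 ^ j] plus the index used in [L_fin]. *)
Definition arc_index n j k : bool :=
  (2 ^ (j - 8 * n) < k)%N && (k + 2 ^ (j - 8 * n) < 2 ^ j.+1)%N.

Definition Tfin n j : set R :=
  \bigcup_(k in arc_index n j) [set` `[arc_start n j k, arc_start n j k + arc_length n j]].
Definition Tinf n : set R :=
  [set` `[2 ^- n - 2 ^- (2 * n) + 2 ^- (10 * n), 2 ^- n + 2 ^- (2 * n) - 2 ^- (10 * n)]].
Definition Tset (A : nat -> prog) n : set R :=
  [set t | (exists2 l, halts_in_exactly (A n) l & Tfin n (maxn l (8 * n)) t) \/
           ((forall l, ~ halts_in_exactly (A n) l) /\ Tinf n t)].

Definition endpt n (b : bool) : R :=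
  2 * pi * (if b then 2 ^- n + 2 ^- (2 * n) else 2 ^- n - 2 ^- (2 * n)).

(* The power of [(x, y)] with respect to the circle on the diameter between the
   points of the unit circle with arguments [a] and [b]. *)
Definition thales a b x y : R := x ^+ 2 + y ^+ 2 - x * (cos a + cos b)
  - y * (sin a + sin b) + (cos a * cos b + sin a * sin b).

Definition dpower n x y := thales (endpt n false) (endpt n true) x y.

Definition out_Lambda x y :=
  1 <= x ^+ 2 + y ^+ 2 /\ forall n, (10 <= n)%N -> 0 <= dpower n x y.

Lemma exp2V_gt0 n : 0 < 2 ^- n :> R. Proof. by rewrite invr_gt0 exprn_gt0. Qed.

Lemma exp2VD n k : 2 ^- (n + k) = 2 ^- n * 2 ^- k :> R.
Proof. by rewrite exprD invfM. Qed.

Lemma exp2V_mul n j : 2 ^+ j * 2 ^- (n + j) = 2 ^- n :> R.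
Proof. by rewrite exprD invfM mulrCA divff ?mulr1 ?expf_neq0. Qed.

Lemma exp2V_le n k : (k <= n)%N -> 2 ^- n <= 2 ^- k :> R.
Proof. by move=> kn; rewrite lef_pV2 ?posrE ?exprn_gt0// ler_weXn2l// ler1n. Qed.

Lemma normcE x y : normc (x +i* y)%C = Num.sqrt (x ^+ 2 + y ^+ 2).
Proof. by []. Qed.

Lemma disk_on_diameterE a b x y :
  disk_on_diameter (cos a +i* sin a)%C (cos b +i* sin b)%C (x +i* y)%C <->
  thales a b x y < 0.
Proof.
have sq (u v p q : R) : (Num.sqrt (u ^+ 2 + v ^+ 2) < Num.sqrt (p ^+ 2 + q ^+ 2) / 2)
    = (4 * (u ^+ 2 + v ^+ 2) < p ^+ 2 + q ^+ 2).
  have uv : 0 <= u ^+ 2 + v ^+ 2 by rewrite addr_ge0 ?sqr_ge0.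
  have pq : 0 <= p ^+ 2 + q ^+ 2 by rewrite addr_ge0 ?sqr_ge0.
  rewrite -(@ltr_pXn2r _ 2%N) ?nnegrE ?sqrtr_ge0 ?divr_ge0//.
  by rewrite expr_div_n !sqr_sqrtr//; apply/idP/idP; lra.
have half (u v : R) : ((u +i* v) / 2 = (u / 2) +i* (v / 2))%C.
  apply/esym/(canRL (mulfK _)); first by rewrite pnatr_eq0.
  by rewrite mulr_natr mulr2n; congr (_ +i* _)%C; field.
have add (u v p q : R) : ((u +i* v) + (p +i* q) = (u + p) +i* (v + q))%C by [].
have sub (u v p q : R) : ((u +i* v) - (p +i* q) = (u - p) +i* (v - q))%C by [].
rewrite /disk_on_diameter /mkset add half !sub.
rewrite !normcE sq -subr_lt0.
set lhs := (X in X < 0); have -> : lhs = 4 * thales a b x y.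
  by rewrite /lhs /thales; field.
by rewrite pmulr_rlt0.
Qed.

Lemma LambdaE x y : Lambda R (x +i* y)%C <-> ~ out_Lambda x y.
Proof.
have nE : (normc (x +i* y)%C < 1) = (x ^+ 2 + y ^+ 2 < 1).
  rewrite normcE -[X in _ < X]sqrtr1 ltr_sqrt//.
have DE n : Ddisk n (x +i* y)%C <-> dpower n x y < 0.
  exact: disk_on_diameterE.
rewrite /Lambda /out_Lambda; split=> [[/=|[n n10 /DE d]]|h].
- by rewrite nE => h [h' _]; move: h; rewrite ltNge h'.
- by move=> [_ /(_ n n10)]; rewrite leNgt d.
- apply: contrapT => hn; apply: h; split.
    by rewrite leNgt -nE; apply/negP => h; apply: hn; left.
  move=> n n10; rewrite leNgt; apply/negP => /DE h; apply: hn; right.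
  by exists n.
Qed.

Lemma endpt_bound n b : (10 <= n)%N ->
  0 < endpt n b /\ endpt n b <= pi * 4 * 2 ^- n.
Proof.
move=> n10; have h : 2 ^- (2 * n) < 2 ^- n :> R.
  by rewrite ltf_pV2 ?posrE ?exprn_gt0// ltr_eXn2l ?ltr1n//; lia.
have := exp2V_gt0 (2 * n); have := pi_gt0 R; rewrite /endpt.
move: h; move: (2 ^- n) (2 ^- (2 * n)) (pi : R) => u v p.
by case: b; split; nra.
Qed.

Lemma exp2V_n10 n : (10 <= n)%N -> 2 ^- n <= 1 / 16 :> R.
Proof.
move=> n10; apply: le_trans (exp2V_le (leq_trans _ n10) : _ <= 2 ^- 4) _ => //.
by rewrite (_ : 2 ^- 4 = 1 / 16)//; field.
Qed.

(** In the half difference p and half sum q of the angles, the power of 1 is 2 cos p (cos p - cos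
    q), and 0 <= p <= q < pi/2. This puts the limit point 1 of the construction in K. *)
Lemma thales_ge0_1 a b : 0 <= a -> a <= b -> b <= 1 -> 0 <= thales a b 1 0.
Proof.
move=> a0 ab b1.
have -> : thales a b 1 0 =
    2 * cos ((b - a) / 2) * (cos ((b - a) / 2) - cos ((a + b) / 2)).
  have -> : thales a b 1 0 = 1 - cos a - cos b + cos (b - a).
    by rewrite cosB /thales; ring.
  set p := (b - a) / 2; set q := (a + b) / 2.
  have -> : a = q - p by rewrite /p /q; field.
  have -> : b = q + p by rewrite /p /q; field.
  have -> : q + p - (q - p) = p *+ 2 by ring.
  by rewrite cos_mulr2n cosB cosD; ring.
have pi2 := pi_ge2 R.
rewrite !mulr_ge0// ?subr_ge0.
  by apply: cos_ge0_pihalf; lra.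
rewrite leNgt ltr_cos ?in_itv/= -?leNgt; lra.
Qed.

Lemma out_Lambda_1 : out_Lambda 1 0.
Proof.
split=> [|n n10]; first by rewrite expr1n expr0n addr0.
have [a0 _] := endpt_bound false n10; have [b0 b1] := endpt_bound true n10.
apply: thales_ge0_1; first exact: ltW.
  by rewrite /endpt ler_pM2l ?mulr_gt0 ?pi_gt0//; have := exp2V_gt0 (2 * n); lra.
apply: le_trans b1 _; have := exp2V_n10 n10; have := pihalf_lt2 R.
have := pi_gt0 R; move: (pi : R) (2 ^- n) (exp2V_gt0 n) => p u u0; nra.
Qed.

Lemma shortest_arcE a l : 0 < l -> l < 1 / 2 ->
  shortest_arc a (a + l) = @circle_point R @` [set` `[a, a + l]].
Proof.
move=> l0 l2; rewrite /shortest_arc (_ : a + l - a = l); last by ring.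
have -> : Num.floor (l + 1 / 2) = 0.
  by apply/eqP; rewrite floor_eq/= ; lra.
rewrite subr0; apply/seteqP; split=> _ [t /= ht <-].
  exists (a + t * l) => //; move: ht; rewrite !in_itv/= => /andP[t0 t1].
  by rewrite lerDl mulr_ge0 ?(ltW l0)//= lerD2l ler_piMl// ltW.
exists ((t - a) / l); last by rewrite divfK ?gt_eqF//; congr circle_point; ring.
move: ht; rewrite !in_itv/= => /andP[at0 ta].
by rewrite divr_ge0 ?(ltW l0)//= ?subr_ge0// ler_pdivrMr// mul1r; lra.
Qed.

Lemma arc_length_gt0 n j : 0 < arc_length n j.
Proof. exact: expR_gt0. Qed.

Lemma arc_length_le n j : arc_length n j <= 2 ^- (2 * n + 2 * j).
Proof.
rewrite /arc_length expRN lef_pV2 ?posrE ?exprn_gt0 ?expR_gt0//.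
by apply: le_trans (expR_ge1Dx _); rewrite lerDr.
Qed.

Lemma LfinE n j : (10 <= n)%N -> (8 * n <= j)%N ->
  @L_fin R n j = @circle_point R @` Tfin n j.
Proof.
move=> n10 nj; have l2 : arc_length n j < 1 / 2.
  apply: le_lt_trans (arc_length_le _ _) _.
  apply: le_lt_trans (exp2V_n10 _) _; [lia|lra].
have startE (k : nat) : arc_start n j k =
    2 ^- n + ((Posz k - Posz (2 ^ j)%N)%:~R) * 2 ^- (2 * n + j).
  by rewrite /arc_start intrB -!pmulrn natrX -{1}(exp2V_mul (2 * n) j); ring.
rewrite image_bigcup; apply/seteqP; split=> [z [k /= kk]|z [k /= kk]].
- rewrite -/(arc_length n j) shortest_arcE// ?arc_length_gt0// => zk.
  have [k' k'E] : exists k' : nat, k = (Posz k' - Posz (2 ^ j)%N)%R.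
    exists (absz (k + Posz (2 ^ j)%N)%R); rewrite gez0_abs ?addrK//.
    by move: kk; rewrite -!natrX; lia.
  exists k'; last by rewrite startE -k'E.
  rewrite /arc_index; move: kk; rewrite k'E -!natrX expnS; lia.
- move=> zk; exists (Posz k - Posz (2 ^ j)%N)%R.
    by move: kk; rewrite /arc_index /= -!natrX expnS; lia.
  by cbv zeta beta; rewrite -startE -/(arc_length n j) shortest_arcE ?arc_length_gt0.
Qed.

Lemma LinfE n : (10 <= n)%N -> @L_inf R n = @circle_point R @` Tinf n.
Proof.
move=> n10; rewrite /L_inf /Tinf.
set a := 2 ^- n - _ + _; set b := _ - _.
have lt : 2 ^- (10 * n) < 2 ^- (2 * n) :> R.
  by rewrite ltf_pV2 ?posrE ?exprn_gt0// ltr_eXn2l ?ltr1n//; lia.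
have le : 2 ^- (2 * n) <= 1 / 16 :> R by apply: exp2V_n10; lia.
have -> : b = a + (b - a) by ring.
have := exp2V_gt0 (10 * n) => gt.
by apply: shortest_arcE; rewrite /a /b; lra.
Qed.

Lemma LsetE A n : (10 <= n)%N -> Lset A n = @circle_point R @` Tset A n.
Proof.
move=> n10; apply/seteqP; split=> [z [[l hl]|[hl]]|_ [t [[l hl tl]|[hl tl]] <-]].
- by rewrite LfinE ?leq_maxr// => -[t tl <-]; exists t => //; left; exists l.
- by rewrite LinfE// => -[t tl <-]; exists t => //; right.
- by left; exists l => //; rewrite LfinE ?leq_maxr//; exists t.
- by right; split=> //; rewrite LinfE//; exists t.
Qed.

Definition circ t : sphere R := Some (circle_point t).

Lemma circE t : circ t = pt (cos (2 * pi * t)) (sin (2 * pi * t)).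
Proof. by []. Qed.

Definition Kset A : set (sphere R) := ~` (Some @` Omega R A).

Lemma KsetP A (p : sphere R) : Kset A p <->
  [\/ p = None, exists x y, p = pt x y /\ out_Lambda x y |
    exists n t, [/\ (10 <= n)%N, Tset A n t & p = circ t]].
Proof.
case: p => [[x y]|]; last by split=> [_|_ [? //]]; constructor 1.
split=> [h|].
  have [oL|/LambdaE zL] := pselect (out_Lambda x y); first by constructor 2; exists x, y.
  have [[n n10 zn]|nz] := pselect ((\bigcup_(n in [set n | (10 <= n)%N]) Lset A n) (x +i* y)%C).
    constructor 3; move: zn; rewrite LsetE// => -[t tn tz].
    by exists n, t; rewrite /circ tz.
  by exfalso; apply: h; exists (x +i* y)%C.
case=> [//|[u [v [[<- <-] h]]]|[n [t [n10 tn e]]]] -[z [zL zN] [ez]].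
- by move: zL; rewrite ez => /LambdaE; apply.
- apply: zN; exists n => //; rewrite LsetE// ez; exists t => //.
  by case: e => -> ->.
Qed.

Lemma Tset_bound A n t : (10 <= n)%N -> Tset A n t -> `|t - 2 ^- n| <= 2 ^- (2 * n).
Proof.
move=> n10 [[l hl]|[hl]]; rewrite ler_norml.
- set j := maxn _ _; move=> [k]; rewrite /= /arc_index in_itv/= => /andP[k0 kj] /andP[h1 h2].
  have e : 2 ^- (2 * n) = 2 ^+ j * 2 ^- (2 * n + j) :> R.
    by rewrite exp2V_mul.
  (* An arc is no longer than the spacing, and 2^(-2n) is 2^j spacings; so the bound k + 1 <= 2 *
     2^j keeps the whole arc in range. *)
  have ub : arc_length n j <= 2 ^- (2 * n + j).
    by apply: le_trans (arc_length_le _ _) (exp2V_le _); lia.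
  have kle : k%:R + 1 <= 2 * 2 ^+ j :> R.
    by rewrite -natrX natr1 -natrM ler_nat -expnS (leq_trans _ kj)// ltnS leq_addr.
  move: h1 h2 ub; rewrite /arc_start e.
  have := exp2V_gt0 (2 * n + j); have : 0 <= k%:R :> R by [].
  move: (2 ^- (2 * n + j)) (k%:R) (2 ^+ j) kle (2 ^- n) (arc_length n j).
  by move=> u k' J kle v l'; nra.
- rewrite /Tinf /= in_itv/= => /andP[h1 h2].
  by have h := exp2V_gt0 (10 * n); apply/andP; split; lra.
Qed.

Lemma Tset_bounds A n t : (10 <= n)%N -> Tset A n t -> 0 <= t <= 2 * 2 ^- n.
Proof.
move=> n10 /(Tset_bound n10); rewrite ler_norml => /andP[h1 h2].
have h : 2 ^- (2 * n) <= 2 ^- n :> R by apply: exp2V_le; lia.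
by apply/andP; split; lra.
Qed.

Lemma closed_Tset A n : closed (Tset A n).
Proof.
have [[l hl]|nl] := pselect (exists l, halts_in_exactly (A n) l).
  have -> : Tset A n = Tfin n (maxn l (8 * n)).
    apply/seteqP; split=> [t [[l' hl' tl]|[/(_ l)//]]|t tl]; last by left; exists l.
    by rewrite (halts_in_inj hl hl').
  apply: closed_bigcup => [|k _]; last exact: itv_closed.
  apply: sub_finite_set (finite_II (2 ^ (maxn l (8 * n)).+1)) => k; rewrite /= /arc_index => /andP[_ kj].
  by apply: leq_ltn_trans kj; exact: leq_addr.
have -> : Tset A n = Tinf n; last exact: itv_closed.
apply/seteqP; split=> [t [[l hl _]|[]//]|t tn]; first by case: nl; exists l.
by right; split=> // l hl; apply: nl; exists l.
Qed.

Definition Tall A : set R :=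
  [set t | t = 0 \/ exists2 n, (10 <= n)%N & Tset A n t].

Lemma compact_Tall A : compact (Tall A).
Proof.
have sub01 : Tall A `<=` [set` `[0, 1 : R]].
  move=> t [->|[n n10 tn]]; rewrite /= in_itv/=; first by rewrite lexx ler01.
  have /andP[-> h] := Tset_bounds n10 tn; apply: le_trans h _.
  by have := exp2V_n10 n10; lra.
apply: subclosed_compact sub01; last exact: segment_compact.
(* Infinitely many closed sets are united here. At stage N the tail n >= N is absorbed by a closed
   interval shrinking to 0, so each stage is a finite union, and the intersection of the stages is
   closed. *)
have -> : Tall A = \bigcap_(N in setT)
    (\bigcup_(n in [set n | (10 <= n < N)%N]) Tset A n `|` [set` `[0, 2 * 2 ^- N : R]]).
  apply/seteqP; split=> [t [->|[n n10 tn]] N _|t h].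
  - by right; rewrite /= in_itv/= lexx mulr_ge0// ltW// exp2V_gt0.
  - have [nN|Nn] := ltnP n N; first by left; exists n => //=; rewrite n10.
    right; rewrite /= in_itv/=; have /andP[-> h] := Tset_bounds n10 tn.
    by apply: le_trans h _; rewrite ler_pM2l// exp2V_le.
  - have [->|t0] := eqVneq t 0; first by left.
    right; have tpos : 0 < t.
      have [[n /andP[n10 _] tn]|] := h 0%N I.
        by have /andP[h0 _] := Tset_bounds n10 tn; rewrite lt_neqAle eq_sym t0.
      by rewrite /= in_itv/= => /andP[h0 _]; rewrite lt_neqAle eq_sym t0.
    have [N hN] : exists N, 2 * 2 ^- N < t.
      have t2 : 0 <= 2 / t by rewrite divr_ge0// ltW.
      exists (Num.truncn (2 / t)).+1; rewrite ltr_pdivrMr ?exprn_gt0//.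
      rewrite -ltr_pdivrMl// mulrC.
      apply: lt_trans (truncnS_gt _) _; rewrite -natrX ltr_nat; exact: ltn_expl.
    have [[n /andP[n10 _] tn]|] := h N I; first by exists n.
    by rewrite /= in_itv/= => /andP[_]; rewrite leNgt hN.
apply: closed_bigI => N _; apply: closedU; last exact: itv_closed.
apply: closed_bigcup => [|n _]; last exact: closed_Tset.
by apply: sub_finite_set (finite_II N) => n /= /andP[].
Qed.
End Complement.

(** * Compactness of K *)

Section Compactness.
Variable R : realType.
Implicit Types u v : R * R * R.

Definition stereo_inv u : sphere R :=
  if u.2 == 1 then None else pt (u.1.1 / (1 - u.2)) (u.1.2 / (1 - u.2)).

Lemma stereo_invK u : dot3 u u = 1 -> stereo (stereo_inv u) = u.
Proof.
move: u => [[a b] c]; rewrite /dot3/= => h; rewrite /stereo_inv /=.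
have [c1|c1] := eqVneq c 1.
  have [-> ->] : a = 0 /\ b = 0 by split; nra.
  by rewrite c1.
have c1' : 1 - c != 0 by rewrite subr_eq0 eq_sym.
have q : (a / (1 - c)) ^+ 2 + (b / (1 - c)) ^+ 2 = (1 + c) / (1 - c).
  have -> : (a / (1 - c)) ^+ 2 + (b / (1 - c)) ^+ 2 = (a * a + b * b) / (1 - c) ^+ 2.
    by field.
  have -> : a * a + b * b = (1 - c) * (1 + c) by lra.
  by field.
rewrite /= q.
have e : (1 + c) / (1 - c) + 1 != 0.
  have -> : (1 + c) / (1 - c) + 1 = 2 / (1 - c) by field.
  by rewrite mulf_neq0// invr_eq0.
by congr (_, _, _); field; rewrite c1' /= ?e //; apply/eqP; lra.
Qed.

Lemma stereoK : cancel (@stereo R) stereo_inv.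
Proof. by move=> p; apply: stereo_inj; rewrite stereo_invK// dot3_stereoxx. Qed.

Lemma fst_continuous (U V : topologicalType) : continuous (@fst U V).
Proof. by move=> p; exact: cvg_fst. Qed.

Lemma snd_continuous (U V : topologicalType) : continuous (@snd U V).
Proof. by move=> p; exact: cvg_snd. Qed.

Lemma coord1_continuous : continuous (fun u : R * R * R => u.1.1).
Proof.
by move=> u; exact: (cvg_comp _ _ (@fst_continuous _ _ u) (@fst_continuous _ _ u.1)).
Qed.

Lemma coord2_continuous : continuous (fun u : R * R * R => u.1.2).
Proof.
by move=> u; exact: (cvg_comp _ _ (@fst_continuous _ _ u) (@snd_continuous _ _ u.1)).
Qed.

Lemma coord3_continuous : continuous (fun u : R * R * R => u.2).
Proof. exact: snd_continuous. Qed.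

Lemma continuous_affine3 (p q r s : R) :
  continuous (fun u : R * R * R => u.1.1 * p + u.1.2 * q + u.2 * r + s).
Proof.
move=> u; apply: cvgD; last exact: cvg_cst.
apply: cvgD; last by apply: cvgM; [exact: coord3_continuous|exact: cvg_cst].
by apply: cvgD; apply: cvgM;
  [exact: coord1_continuous|exact: cvg_cst|exact: coord2_continuous|exact: cvg_cst].
Qed.

Lemma continuous_dot3 : continuous (fun u : R * R * R => dot3 u u).
Proof.
move=> u; apply: cvgD; last by apply: cvgM; exact: coord3_continuous.
by apply: cvgD; apply: cvgM;
  [exact: coord1_continuous|exact: coord1_continuous
  |exact: coord2_continuous|exact: coord2_continuous].
Qed.

(** For [u] fixed on the sphere, [dot3 v u] is affine in [v] and equals 1 at [u]; [mdist_le_chord]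
    turns closeness to 1 into closeness in the geodesic metric, at infinity as elsewhere. *)
Lemma stereo_inv_continuous (A : set (R * R * R)) :
  (forall u, A u -> dot3 u u = 1) -> {within A, continuous stereo_inv}.
Proof.
move=> A1; apply/subspace_continuousP => u Au.
apply/metricType_numDomainType.cvgrPdist_lt => e e0.
have lt1 : 1 - (e / 2) ^+ 2 / 32 < u.1.1 * u.1.1 + u.1.2 * u.1.2 + u.2 * u.2 + 0.
  have := A1 u Au; rewrite /dot3 addr0 => ->.
  by rewrite ltrBlDr ltrDl divr_gt0// exprn_gt0// divr_gt0.
have near1 : nbhs u (fun v => 1 - (e / 2) ^+ 2 / 32 <
    v.1.1 * u.1.1 + v.1.2 * u.1.2 + v.2 * u.2 + 0).
  exact: cvgr_gt _ (@continuous_affine3 u.1.1 u.1.2 u.2 0 u) _ lt1.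
suff : nbhs u (fun v => A v -> mdist (stereo_inv u) (stereo_inv v) < e) by [].
apply: filterS near1 => v h Av.
apply: le_lt_trans (_ : e / 2 < e); last by lra.
apply: mdist_le_chord; first by rewrite ltW// divr_gt0.
rewrite !stereo_invK; [|exact: A1..].
by move: h; rewrite /dot3; lra.
Qed.

(** The power of a point, multiplied by 2 / (|p|^2 + 1), becomes affine in the stereographic
    coordinates. The outside of a disc is thus a closed half-space cut with the sphere, and infinity
    needs no separate treatment. *)
Definition disk_form a b u : R :=
  1 + u.2 - u.1.1 * (cos a + cos b) - u.1.2 * (sin a + sin b)
  + (1 - u.2) * (cos a * cos b + sin a * sin b).

Lemma disk_form_stereo a b x y :
  disk_form a b (stereo (pt x y)) = 2 / (x ^+ 2 + y ^+ 2 + 1) * thales a b x y.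
Proof.
rewrite /disk_form /thales /=; field.
by rewrite gt_eqF// ltr_wpDl// addr_ge0 ?sqr_ge0.
Qed.

Definition outer_cap : set (R * R * R) :=
  [set u | dot3 u u = 1] `&` [set u | 0 <= u.2] `&`
  \bigcap_(n in [set n | (10 <= n)%N])
    [set u | 0 <= disk_form (endpt R n false) (endpt R n true) u].

Lemma outer_cap_image :
  stereo_inv @` outer_cap = [set p | p = None \/ exists x y, p = pt x y /\ out_Lambda x y].
Proof.
have pos (x y : R) : 0 < x ^+ 2 + y ^+ 2 + 1.
  by rewrite ltr_wpDl// addr_ge0 ?sqr_ge0.
have capE (x y : R) : outer_cap (stereo (pt x y)) <-> out_Lambda x y.
  have e n : (0 <= disk_form (endpt R n false) (endpt R n true) (stereo (pt x y)))
      = (0 <= dpower n x y).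
    by rewrite disk_form_stereo pmulr_rge0// divr_gt0.
  have e' : (0 <= (stereo (pt x y)).2) = (1 <= x ^+ 2 + y ^+ 2).
    by rewrite /= pmulr_lge0 ?invr_gt0// subr_ge0.
  rewrite /outer_cap /out_Lambda; split=> [[[_ /= h1] h2]|[h1 h2]].
    by split=> [|n n10]; [rewrite -e'|rewrite -e; exact: h2].
  split; first by split; [exact: dot3_stereoxx|rewrite /mkset e'].
  by move=> n n10; rewrite /mkset e; exact: h2.
apply/seteqP; split=> [_ [u cu <-]|p].
  have := cu; have [[u1 _] _] := cu; rewrite -{1}(stereo_invK u1).
  case: (stereo_inv u) => [[x y]|]; last by left.
  by move=> /capE; right; exists x, y.
move=> h; exists (stereo p); last exact: stereoK.
case: h => [->|[x [y [-> /capE//]]]].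
split; first by split; [exact: dot3_stereoxx|rewrite /mkset /= ler01].
by move=> n _; rewrite /mkset /disk_form /= !mul0r; lra.
Qed.

Lemma compact_outer_cap : compact outer_cap.
Proof.
pose I : set R := [set` `[-1, 1]].
have cI : compact I by exact: segment_compact.
apply: (@subclosed_compact _ _ (I `*` I `*` I)).
- apply: closedI; first apply: closedI.
  + apply: (@preimage_closed _ _ (fun u => dot3 u u) [set x | x = 1]).
      by move=> u _; exact: continuous_dot3.
    exact: closed_eq.
  + apply: (@preimage_closed _ _ (fun u : R * R * R => u.2) [set x | 0 <= x]).
      by move=> u _; exact: snd_continuous.
    exact: closed_ge.
  + apply: closed_bigI => n _; set a := endpt _ _ _; set b := endpt _ _ _.
    rewrite (_ : [set u | _] = (fun u : R * R * R =>
      u.1.1 * - (cos a + cos b) + u.1.2 * - (sin a + sin b)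
      + u.2 * (1 - (cos a * cos b + sin a * sin b))
      + (1 + (cos a * cos b + sin a * sin b))) @^-1` [set x | 0 <= x]).
      apply: preimage_closed; last exact: closed_ge.
      by move=> u _; exact: continuous_affine3.
    apply/seteqP; split=> u; rewrite /preimage /mkset /disk_form;
      by move=> h; apply: le_trans h _; rewrite le_eqVlt; apply/orP; left; apply/eqP; ring.
- by apply: compact_setX => //; exact: compact_setX.
- move=> [[x y] z] [[/= h _] _]; move: h; rewrite /dot3/= => h.
  by rewrite /I; split; [split|]; rewrite /= in_itv/=; apply/andP; split; nra.
Qed.

Lemma circ_continuous : continuous (@circ R).
Proof.
move=> t; apply/metricType_numDomainType.cvgrPdist_lt => e e0.
have p0 : 0 < 2 * pi :> R by rewrite mulr_gt0 ?pi_gt0.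
have := nbhsx_ballx t _ (divr_gt0 e0 p0); apply: filterS => s.
rewrite /ball/= => h; rewrite !circE; apply: le_lt_trans (mdist_circle _ _) _.
by rewrite -mulrBr normrM (gtr0_norm p0) mulrC -ltr_pdivlMr.
Qed.

Lemma compact_Kset A : compact (@Kset R A).
Proof.
have -> : @Kset R A = stereo_inv @` outer_cap `|` @circ R @` @Tall R A.
  rewrite outer_cap_image; apply/seteqP; split=> p.
    move=> /KsetP[->|h|[n [t [n10 tn ->]]]]; [by left; left|by left; right|].
    by right; exists t => //; right; exists n.
  move=> [[->|h]|[t [->|[n n10 tn]] <-]]; apply/KsetP.
  - by constructor 1.
  - by constructor 2.
  - constructor 2; exists 1, 0; split; last exact: out_Lambda_1.
    by rewrite circE mulr0 cos0 sin0.
  - by constructor 3; exists n, t.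
apply: compactU.
  apply: continuous_compact compact_outer_cap.
  by apply: stereo_inv_continuous => u [[]].
apply: continuous_compact (@compact_Tall R A).
by apply: continuous_subspaceT; exact: circ_continuous.
Qed.
End Compactness.

(** * Approximation of the arcs *)

(** The offset [d / 2 ^ E] is compared with a rational upper approximation of the arc length: no
    point of the arc is lost, and the points added lie only slightly beyond its end. *)
Definition arc_test Q E n j k d : bool :=
  arc_index n j k &&
  (d * Q.+1 ^ (Q * 2 ^ (2 * n + 2 * j)) <= 2 ^ E * Q ^ (Q * 2 ^ (2 * n + 2 * j)))%N.

Definition arc_num E n j k d : nat :=
  (2 ^ (E - n) - 2 ^ (E - 2 * n) + k * 2 ^ (E - (2 * n + j)) + d)%N.

(* The value of [j] that can be found by running the machine for [8 s] steps. *)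
Definition arc_level s (e : nat) n := maxn (cutoff e (8 * s)) (8 * n).

Section Arcs.
Variable R : realType.
Implicit Types t : R.

Lemma exp2V_natr E k : (k <= E)%N -> (2 ^ (E - k))%N%:R = 2 ^+ E * 2 ^- k :> R.
Proof.
by move=> kE; rewrite natrX -{2}(subnK kE) exprD mulfK// expf_neq0.
Qed.

Lemma arc_numE E n j k d : (2 * n + j <= E)%N ->
  (arc_num E n j k d)%:R / 2 ^+ E = arc_start R n j k + d%:R / 2 ^+ E.
Proof.
move=> nE; rewrite /arc_num /arc_start !natrD natrM natrB; last first.
  by rewrite leq_exp2l//; lia.
rewrite !exp2V_natr//; [|lia..].
by field; rewrite !expf_neq0.
Qed.

Lemma arc_testE Q E n j k d : (0 < Q)%N -> arc_test Q E n j k d =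
  arc_index n j k &&
  (d%:R / 2 ^+ E <= (Q%:R / Q.+1%:R : R) ^+ (Q * 2 ^ (2 * n + 2 * j))).
Proof.
move=> Q0; rewrite /arc_test; congr andb.
rewrite expr_div_n ler_pdivrMr ?exprn_gt0// mulrAC ler_pdivlMr ?exprn_gt0//.
by rewrite -!natrX -!natrM ler_nat mulnC [X in _ = (_ <= X)%N]mulnC.
Qed.

Lemma arc_length_approx Q n j : (0 < Q)%N ->
  arc_length R n j <= (Q%:R / Q.+1%:R) ^+ (Q * 2 ^ (2 * n + 2 * j)) <=
  arc_length R n j + 2 ^+ (2 * n + 2 * j) / Q%:R.
Proof.
move=> Q0; have := expN_approx R (2 ^ (2 * n + 2 * j)) Q0.
rewrite natrX -/(arc_length R n j) => /andP[-> h] /=.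
apply: le_trans h _; rewrite lerD2l ler_pM2l ?exprn_gt0//.
by rewrite lef_pV2 ?posrE ?ltr0n// ler_nat.
Qed.

Lemma exp2_split n j : (8 * n <= j)%N ->
  2 ^- (2 * n) = 2 ^+ j * 2 ^- (2 * n + j) :> R /\
  2 ^- (10 * n) = 2 ^+ (j - 8 * n) * 2 ^- (2 * n + j) :> R.
Proof.
move=> nj; rewrite exp2V_mul; split=> //.
have -> : (2 * n + j = 10 * n + (j - 8 * n))%N by lia.
by rewrite exp2V_mul.
Qed.

(** Together with [Tinf_dense] this is the convergence of L_n^j to L_n^infinity: left end points of
    arcs lie in the limit interval, and every point of that interval is within two spacings of one
    of them. *)
Lemma Tinf_arc_start n j k : (8 * n <= j)%N -> arc_index n j k ->
  @Tinf R n (arc_start R n j k).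
Proof.
move=> nj /andP[k1 k2]; rewrite /Tinf /= in_itv/= /arc_start.
have [-> ->] := exp2_split nj; have u0 := exp2V_gt0 R (2 * n + j).
have h1 : 2 ^+ (j - 8 * n) <= k%:R :> R by rewrite -natrX ler_nat ltnW.
have h2 : k%:R + 2 ^+ (j - 8 * n) <= 2 * 2 ^+ j :> R.
  by rewrite -exprS -!natrX -natrD ler_nat ltnW.
move: (2 ^- (2 * n + j)) u0 (2 ^+ (j - 8 * n)) (2 ^+ j) (2 ^- n) (k%:R) h1 h2.
by move=> u u0 e N v x h1 h2; apply/andP; split; nra.
Qed.

Lemma Tinf_dense n j t : (10 <= n)%N -> (8 * n <= j)%N -> @Tinf R n t ->
  exists2 k, arc_index n j k & `|t - arc_start R n j k| <= 2 * 2 ^- (2 * n + j).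
Proof.
move=> n10 nj; rewrite /Tinf /= in_itv/= => /andP[].
have [e1 e2] := exp2_split nj; rewrite /arc_start e1 e2.
have u0 := exp2V_gt0 R (2 * n + j).
have jE : (2 * 2 ^ (j - 8 * n) + 2 <= 2 ^ j.+1)%N.
  have : (2 ^ (j - 8 * n).+1 <= 2 ^ j)%N by rewrite leq_exp2l//; lia.
  have : (2 ^ 1 <= 2 ^ j)%N by rewrite leq_exp2l//; lia.
  by rewrite !expnS; lia.
rewrite /arc_index; move: (2 ^- n) (2 ^- (2 * n + j)) u0 => v u u0.
move: jE; rewrite -!natrX; have -> : (2 ^ j)%N%:R = (2 ^ j.+1)%N%:R / 2 :> R by rewrite expnS natrM; field.
move: (2 ^ (j - 8 * n))%N (2 ^ j.+1)%N => e N jE h1 h2.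
pose x := (t - (v - N%:R / 2 * u)) / u.
have tE : t = v - N%:R / 2 * u + x * u by rewrite /x; field; rewrite gt_eqF.
have x1 : e%:R <= x by rewrite -(ler_pM2r u0); lra.
have x2 : x <= N%:R - e%:R by rewrite -(ler_pM2r u0); lra.
suff [k [k1 k2 kx]] : exists k : nat, [/\ (e < k)%N, (k + e < N)%N & `|x - k%:R| <= 2].
  exists k; first by rewrite k1.
  rewrite {1}tE (_ : _ - _ = (x - k%:R) * u); last by ring.
  by rewrite normrM (gtr0_norm u0) ler_pM2r.
have x0 : 0 <= x by apply: le_trans x1.
have /andP[f1 f2] := truncn_itv x0.
set f := Num.truncn x in f1 f2.
have fe : (e <= f)%N.
  by rewrite -ltnS -(@ltr_nat R) (le_lt_trans x1)// natr1.
have fN : (f + e <= N)%N.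
  by rewrite -(@ler_nat R) natrD; lra.
have f2' : x < f%:R + 1 by rewrite natr1.
(* The end points of the interval correspond to [e] and [N - e], which [arc_index] excludes. If
   rounding down hits one of them, the neighbour inside is taken, whence 2 instead of 1; [jE]
   guarantees that the range is nonempty. *)
have [ef|ef] := ltnP e f; last first.
  exists e.+1; split=> //; first by lia.
  have -> : e = f by lia.
  by rewrite -natr1 ler_norml; apply/andP; split; lra.
have [lt|ge] := ltnP (f + e) N.
  by exists f; split=> //; rewrite ler_norml; apply/andP; split; lra.
exists f.-1; split; [lia..|].
have fE : f%:R = f.-1%:R + 1 :> R by rewrite natr1 prednK//; lia.
by rewrite ler_norml; apply/andP; split; lra.
Qed.

Section Level.
Variables (A : nat -> prog) (s n : nat).
Hypotheses (n10 : (10 <= n)%N) (ns : (n < s)%N).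
Variables (j Q E : nat).
Hypotheses (jdef : j = arc_level s (prog_code (A n)) n)
  (Qdef : Q = (2 ^ (20 * s))%N) (Edef : E = (20 * s)%N).

Lemma arc_level_le : (j <= 8 * s)%N.
Proof. by rewrite jdef /arc_level geq_max; apply/andP; split; [exact: cutoff_le|lia]. Qed.

Lemma arc_level_ge : (8 * n <= j)%N.
Proof. by rewrite jdef leq_maxr. Qed.

Let Q0 : (0 < Q)%N. Proof. by rewrite Qdef expn_gt0. Qed.

(** From [n < s] and [j <= 8 * s], the exponent 2 n + 2 j is at most 18 s, while Q is 2^(20 s). *)
Lemma arc_slack : 2 ^+ (2 * n + 2 * j) / Q%:R <= 2 ^- s :> R.
Proof.
rewrite ler_pdivrMr ?ltr0n// mulrC ler_pdivlMr ?exprn_gt0// -exprD Qdef natrX.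
by apply: ler_weXn2l; rewrite ?ler1n//; have := arc_level_le; lia.
Qed.

(** Either the simulation was long enough to know the true level, or the true level, if any, is at
    least 8 s. In the latter case both sets have spacing at most 2^-s, so confusing them is
    harmless. *)
Lemma arc_level_cases :
  (exists2 l, halts_in_exactly (A n) l & maxn l (8 * n) = j) \/
  (forall l, halts_in_exactly (A n) l -> (8 * s <= maxn l (8 * n))%N) /\
   j = (8 * s)%N.
Proof.
have [[l hl]|nl] := pselect (exists l, halts_in_exactly (A n) l); last first.
  have nl' l : ~ halts_in_exactly (A n) l by move=> hl; apply: nl; exists l.
  right; split=> [l /nl'//|]; rewrite jdef /arc_level cutoff_diverges//.
  by apply/maxn_idPl; lia.
have jE : j = maxn (minn l (8 * s)) (8 * n) by rewrite jdef /arc_level (cutoff_halts _ hl).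
have [ls|sl] := leqP l (8 * s); first by left; exists l => //; rewrite jE; lia.
right; split; last by rewrite jE; lia.
by move=> l' hl'; rewrite (halts_in_inj hl' hl); lia.
Qed.

Lemma Tset_arc t : Tset A n t -> exists k d, arc_test Q E n j k d /\
  `|(arc_num E n j k d)%:R / 2 ^+ E - t| <= 4 * 2 ^- s.
Proof.
move=> tn; have js := arc_level_le; have nj := arc_level_ge.
have nE : (2 * n + j <= E)%N by lia.
have s0 := exp2V_gt0 R s.
have test k d : arc_index n j k -> d%:R / 2 ^+ E <= arc_length R n j ->
    arc_test Q E n j k d.
  move=> kj dl; rewrite arc_testE// kj /=; apply: le_trans dl _.
  by have /andP[] := arc_length_approx n j Q0.
have near_inf t' : @Tinf R n t' -> `|t - t'| <= 2 ^- s -> j = (8 * s)%N ->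
    exists k d, arc_test Q E n j k d /\
    `|(arc_num E n j k d)%:R / 2 ^+ E - t| <= 4 * 2 ^- s.
  move=> tinf tt' jE; have [k kj kt] := Tinf_dense n10 nj tinf.
  exists k, 0%N; split; first by apply: test; rewrite ?mul0r ?ltW ?arc_length_gt0.
  have h : 2 ^- (2 * n + j) <= 2 ^- s :> R by apply: exp2V_le; lia.
  rewrite arc_numE// mul0r addr0 distrC; apply: le_trans (ler_distD t' _ _) _; lra.
have [[l hl lj]|[far jE]] := arc_level_cases.
  have [[l' hl' tl]|[/(_ l)//]] := tn.
  move: tl; rewrite (halts_in_inj hl' hl) lj => -[k kj].
  rewrite /= in_itv/= => /andP[t1 t2].
  have x0 : 0 <= (t - arc_start R n j k) * 2 ^+ E.
    by rewrite mulr_ge0 ?subr_ge0// exprn_ge0.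
  have /andP[d1 d2] := truncn_itv x0; set d := Num.truncn _ in d1 d2.
  have E0 : 0 < 2 ^+ E :> R by rewrite exprn_gt0.
  exists k, d; split.
    by apply: test => //; rewrite ler_pdivrMr//; apply: le_trans d1 _;
      rewrite ler_pM2r//; lra.
  rewrite arc_numE//; move: d1 d2; rewrite -ler_pdivrMr// -ltr_pdivlMr// -natr1.
  rewrite mulrDl mul1r => d1 d2; have : 2 ^- E <= 2 ^- s :> R by apply: exp2V_le; lia.
  by move=> h; rewrite ler_norml; apply/andP; split; lra.
have [[l hl [k kj]]|[nl tinf]] := tn; last first.
  by apply: near_inf tinf _ jE; rewrite subrr normr0 ltW.
rewrite /= in_itv/= => /andP[t1 t2]; have lj := far l hl.
(* The machine halts, but too late to be noticed: the left end point of the arc containing [t] is a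
   point of the limit interval within an arc length of [t]. *)
apply: (near_inf (arc_start R n (maxn l (8 * n)) k)) => //.
  by apply: Tinf_arc_start => //; exact: leq_maxr.
apply: le_trans (_ : arc_length R n (maxn l (8 * n)) <= _).
  by rewrite ger0_norm ?subr_ge0//; lra.
by apply: le_trans (arc_length_le _ _ _) _; apply: exp2V_le; lia.
Qed.

Lemma arc_Tset k d : arc_test Q E n j k d -> exists2 t : R, Tset A n t &
  `|(arc_num E n j k d)%:R / 2 ^+ E - t| <= 4 * 2 ^- s.
Proof.
have js := arc_level_le; have nj := arc_level_ge.
have nE : (2 * n + j <= E)%N by lia.
have s0 := exp2V_gt0 R s; have sl := arc_slack.
rewrite arc_testE// => /andP[kj kd].
have {kd} kd : d%:R / 2 ^+ E <= arc_length R n j + 2 ^- s.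
  apply: le_trans kd _; have /andP[_ h] := arc_length_approx n j Q0.
  by apply: le_trans h _; rewrite lerD2l.
have d0 : 0 <= d%:R / 2 ^+ E :> R by rewrite divr_ge0// exprn_ge0.
have l0 := arc_length_gt0 R n j.
rewrite arc_numE//; have [[l hl lj]|[far jE]] := arc_level_cases.
  (* The test may admit offsets beyond the true arc by up to 2^-s; these are pulled back to the end
     of the arc. *)
  exists (arc_start R n j k + Num.min (d%:R / 2 ^+ E) (arc_length R n j)).
    left; exists l => //; rewrite lj; exists k => //.
    rewrite /= in_itv/= lerDl lerD2l ge_min lexx orbT andbT le_min d0.
    exact: ltW.
  move: (d%:R / 2 ^+ E) (arc_length R n j) kd d0 l0 => x y kd d0 l0.
  by rewrite ler_norml minEle; case: ifP => [h|/negbT];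
    rewrite -?ltNge => *; apply/andP; split; lra.
have tinf := Tinf_arc_start nj kj.
have h : arc_length R n j <= 2 ^- s.
  by apply: le_trans (arc_length_le _ _ _) _; apply: exp2V_le; lia.
have [[l hl]|nl] := pselect (exists l, halts_in_exactly (A n) l); last first.
  exists (arc_start R n j k); last by rewrite ler_norml; apply/andP; split; lra.
  by right; split=> // l hl; apply: nl; exists l.
have lj := far l hl.
(* The arc start of level [j] lies in the limit interval, hence near an arc start of the true
   level. *)
have [k' kj' kk'] := Tinf_dense n10 (leq_maxr l (8 * n)) tinf.
exists (arc_start R n (maxn l (8 * n)) k').
  left; exists l => //; exists k' => //.
  by rewrite /= in_itv/= lexx lerDl ltW// arc_length_gt0.
have h' : 2 ^- (2 * n + maxn l (8 * n)) <= 2 ^- s :> R by apply: exp2V_le; lia.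
by move: kk'; rewrite !ler_norml => /andP[k1 k2]; apply/andP; split; lra.
Qed.

End Level.
End Arcs.

(** * The algorithm *)

Lemma cf_ccos k F G : cf k F -> cf k G -> cf k (fun s => ccos (F s) (G s)).
Proof. by move=> hF hG; rewrite /ccos /cpow; cf_auto. Qed.

Lemma cf_csin k F G : cf k F -> cf k G -> cf k (fun s => csin (F s) (G s)).
Proof. by move=> hF hG; rewrite /csin /cpow; cf_auto. Qed.

Lemma cf_cindex k F G H : cf k F -> cf k G -> cf k H ->
  cf k (fun s => cindex (F s) (G s) (H s)).
Proof.
move=> hF hG hH; rewrite /cindex.
have hq : cf k (fun s => cquarter (F s)).
  rewrite /cquarter; apply: cf_sum; first by cf_auto.
  by move=> k' I kk' hI; apply: cf_leq; [cf_auto|apply: cf_ccos; cf_auto].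
by cf_auto.
Qed.

Definition pcos M E D := ccos M (cindex M E D).
Definition psin M E D := csin M (cindex M E D).
Definition pden M E D := ((M ^ 2 + 1) ^ cindex M E D)%N.

Lemma cf_pcos k F G H : cf k F -> cf k G -> cf k H ->
  cf k (fun s => pcos (F s) (G s) (H s)).
Proof. by move=> *; apply: cf_ccos => //; exact: cf_cindex. Qed.

Lemma cf_psin k F G H : cf k F -> cf k G -> cf k H ->
  cf k (fun s => psin (F s) (G s) (H s)).
Proof. by move=> *; apply: cf_csin => //; exact: cf_cindex. Qed.

Lemma cf_pden k F G H : cf k F -> cf k G -> cf k H ->
  cf k (fun s => pden (F s) (G s) (H s)).
Proof. by move=> *; apply: cf_exp; [cf_auto|exact: cf_cindex]. Qed.

(* With [x = (a - W) / H], [y = (b - W) / H] and the points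
   [(C1 + i S1) / X1], [(C2 + i S2) / X2], the inequality [0 <= thales] after
   multiplication by [H ^ 2 * X1 * X2], rearranged so as to avoid subtraction. *)
Definition disk_ineq H W a b C1 S1 X1 C2 S2 X2 : bool :=
  (H * (a * (C1 * X2 + C2 * X1) + b * (S1 * X2 + S2 * X1))
    + 2 * W * (a + b) * (X1 * X2) <=
   (a * a + b * b + 2 * W * W) * (X1 * X2) + H * H * (C1 * C2 + S1 * S2)
    + H * W * (C1 * X2 + C2 * X1 + (S1 * X2 + S2 * X1)))%N.

Lemma cf_disk_ineq k H W a b C1 S1 X1 C2 S2 X2 :
  cf k H -> cf k W -> cf k a -> cf k b ->
  cf k C1 -> cf k S1 -> cf k X1 -> cf k C2 -> cf k S2 -> cf k X2 ->
  cf k (fun s => disk_ineq (H s) (W s) (a s) (b s)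
    (C1 s) (S1 s) (X1 s) (C2 s) (S2 s) (X2 s)).
Proof. by move=> *; rewrite /disk_ineq; cf_auto. Qed.

Definition endnum E n (c : bool) : nat :=
  if c then (2 ^ (E - n) + 2 ^ (E - 2 * n))%N else (2 ^ (E - n) - 2 ^ (E - 2 * n))%N.

Definition disk_accept M E H W n a b : bool :=
  disk_ineq H W a b
    (pcos M E (endnum E n false)) (psin M E (endnum E n false))
    (pden M E (endnum E n false))
    (pcos M E (endnum E n true)) (psin M E (endnum E n true))
    (pden M E (endnum E n true)).

Lemma cf_disk_accept k M E H W n a b :
  cf k M -> cf k E -> cf k H -> cf k W -> cf k n -> cf k a -> cf k b ->
  cf k (fun s => disk_accept (M s) (E s) (H s) (W s) (n s) (a s) (b s)).
Proof.
move=> *; rewrite /disk_accept /endnum.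
by apply: cf_disk_ineq => //; (apply: cf_pcos || apply: cf_psin || apply: cf_pden);
  cf_auto.
Qed.

(** Mesh 2^(-7s) on the square of half-side 2^(s+1). The factor 2 in the half-side leaves room for
    dilating points with coordinates up to 2^s. *)
Definition grid_den s := (2 ^ (7 * s))%N.
Definition grid_off s := (2 ^ (8 * s + 1))%N.

(** The third test is 1 <= x^2 + y^2 multiplied by H^2 and freed of subtractions; the last one runs
    over the discs with 10 <= n < s. *)
Definition grid_accept s i : bool :=
  let a := hd i in let b := hd (tl i) in
  let H := grid_den s in let W := grid_off s in
  [&& (a <= 2 * W)%N, (b <= 2 * W)%N,
      (H * H + 2 * W * (a + b) <= a * a + b * b + 2 * W * W)%N &
      all (fun n => disk_accept (2 ^ (7 * s)) (20 * s) H W (n + 10) a b)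
        (iota 0 (s - 10))].

Lemma cf_grid_accept k F G : cf k F -> cf k G ->
  cf k (fun s => grid_accept (F s) (G s)).
Proof.
move=> hF hG; rewrite /grid_accept /grid_den /grid_off.
apply: cf_andb; first by cf_auto.
apply: cf_andb; first by cf_auto.
apply: cf_andb; first by cf_auto.
apply: (@cf_all _ _ (fun n s => disk_accept (2 ^ (7 * F s)) (20 * F s)
  (2 ^ (7 * F s)) (2 ^ (8 * F s + 1)) (n + 10) (hd (G s)) (hd (tl (G s))))).
  by cf_auto.
by move=> k' I kk' hI; apply: cf_disk_accept; cf_auto.
Qed.

Definition rcode a b c := ccons a (ccons b (ccons c 0)).
Definition bcode x y r := ccons x (ccons y (ccons r 0)).

(** Denominators are entered decreased by one, because the code of a rational stores [c] for the
    denominator [c + 1]; the radius is 2^-s. *)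
Definition grid_item s i :=
  bcode (rcode (hd i) (grid_off s) (grid_den s).-1)
        (rcode (hd (tl i)) (grid_off s) (grid_den s).-1)
        (rcode 1 0 (2 ^ s).-1).

Lemma cf_grid_item k F G : cf k F -> cf k G ->
  cf k (fun s => grid_item (F s) (G s)).
Proof.
by move=> hF hG; rewrite /grid_item /bcode /rcode /grid_off /grid_den; cf_auto.
Qed.

(** Codes of triples increase with each entry, so a single loop over all numbers up to the largest
    code meets every candidate. Numbers that do not code triples are decoded all the same, so
    soundness has to hold for every [i]. *)
Definition grid_bound s := (bcode (2 * grid_off s) (2 * grid_off s) 0).+1.

Definition arc_accept (e : nat -> nat) s i : bool :=
  let n := hd i in let k := hd (tl i) in let d := hd (tl (tl i)) in
  [&& (10 <= n)%N, (n < s)%N &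
      arc_test (2 ^ (20 * s)) (20 * s) n (arc_level s (e n) n) k d].

Lemma cf_arc_level (e : nat -> nat) k F G : computable e -> cf k F -> cf k G ->
  cf k (fun s => arc_level (F s) (e (G s)) (G s)).
Proof.
by move=> he hF hG; rewrite /arc_level; apply: cf_max; [apply: cf_cutoff|]; cf_auto.
Qed.

Lemma cf_arc_test k Q E n j l d :
  cf k Q -> cf k E -> cf k n -> cf k j -> cf k l -> cf k d ->
  cf k (fun s => arc_test (Q s) (E s) (n s) (j s) (l s) (d s)).
Proof. by move=> *; rewrite /arc_test /arc_index; cf_auto. Qed.

Lemma cf_arc_accept (e : nat -> nat) k F G : computable e -> cf k F -> cf k G ->
  cf k (fun s => arc_accept e (F s) (G s)).
Proof.
move=> he hF hG; rewrite /arc_accept; apply: cf_andb; first by cf_auto.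
apply: cf_andb; first by cf_auto.
by apply: cf_arc_test; [cf_auto..|apply: cf_arc_level => //|cf_auto|cf_auto]; cf_auto.
Qed.

Definition arc_item (e : nat -> nat) s i :=
  let n := hd i in let k := hd (tl i) in let d := hd (tl (tl i)) in
  let D := arc_num (20 * s) n (arc_level s (e n) n) k d in
  let M := (2 ^ (7 * s))%N in
  bcode (rcode (pcos M (20 * s) D) 0 (pden M (20 * s) D).-1)
        (rcode (psin M (20 * s) D) 0 (pden M (20 * s) D).-1)
        (rcode 1 0 (2 ^ s).-1).

Lemma cf_arc_item (e : nat -> nat) k F G : computable e -> cf k F -> cf k G ->
  cf k (fun s => arc_item e (F s) (G s)).
Proof.
move=> he hF hG; rewrite /arc_item; cbv zeta.
have hl : cf k (fun s => arc_level (F s) (e (hd (G s))) (hd (G s))).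
  by apply: cf_arc_level => //; cf_auto.
have hD : cf k (fun s => arc_num (20 * F s) (hd (G s))
    (arc_level (F s) (e (hd (G s))) (hd (G s))) (hd (tl (G s))) (hd (tl (tl (G s))))).
  by rewrite /arc_num; cf_auto.
have hM : cf k (fun s => 2 ^ (7 * F s))%N by cf_auto.
have hE : cf k (fun s => 20 * F s)%N by cf_auto.
have := cf_pcos hM hE hD; have := cf_psin hM hE hD; have := cf_pden hM hE hD.
by rewrite /bcode /rcode => *; cf_auto.
Qed.

Definition arc_bound s := (bcode s (2 ^ (8 * s + 1)) (2 ^ (20 * s))).+1.

Definition collect (B : nat) (T : nat -> bool) (item : nat -> nat) c :=
  iteri B (fun i acc => if T i then ccons (item i) acc else acc) c.

Lemma mem_collect B T item c x : x \in CodeSeq.decode (collect B T item c) <->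
  (exists i, [/\ (i < B)%N, T i & x = item i]) \/ x \in CodeSeq.decode c.
Proof.
elim: B => [|B IHB]; first by split=> [|[[i [//]]|]]; [right|].
rewrite /collect [iteri _ _ _]/= -/(collect B T item c).
have inS : (exists i, [/\ (i < B)%N, T i & x = item i]) ->
    exists i, [/\ (i < B.+1)%N, T i & x = item i].
  by move=> [i [iB Ti xi]]; exists i; split=> //; exact: ltnW.
case: ifP => TB.
  rewrite -[collect B T item c]CodeSeq.decodeK cconsE CodeSeq.codeK in_cons.
  split=> [/orP[/eqP ->|/IHB[/inS|]]|[[i [iB Ti xi]]|xc]]; [left|by left|by right| |].
  - by exists B.
  - have [iB'|ne] := eqVneq i B; first by rewrite xi iB' eqxx.
    apply/orP; right; apply/IHB; left; exists i; split=> //.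
    by rewrite ltn_neqAle ne.
  - by apply/orP; right; apply/IHB; right.
split=> [/IHB[/inS|]|[[i [iB Ti xi]]|xc]]; [by left|by right| |].
  apply/IHB; left; exists i; split=> //; rewrite ltn_neqAle -ltnS iB andbT.
  by apply/eqP => iE; move: Ti; rewrite iE TB.
by apply/IHB; right.
Qed.

Definition alg (e : nat -> nat) s :=
  collect (arc_bound s) (arc_accept e s) (arc_item e s)
    (collect (grid_bound s) (grid_accept s) (grid_item s) 0).

Lemma computable_alg (e : nat -> nat) c : computable e ->
  computable (fun m => alg e (m + c)).
Proof.
move=> he; apply: cf_computableP.
have hs : cf 1 (fun s => s 0 + c)%N by apply: cf_add; [exact: cf_var|exact: cf_const].
rewrite /alg /collect; apply: cf_iteri.
- by rewrite /arc_bound /bcode; cf_auto.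
- apply: cf_iteri; first by rewrite /grid_bound /bcode /grid_off; cf_auto.
    exact: cf_0.
  move=> k I X k1 hI hX; have hs' := cf_le k1 hs.
  by apply: cf_if => //; [exact: cf_grid_accept|apply: cf_ccons => //; exact: cf_grid_item].
- move=> k I X k1 hI hX; have hs' := cf_le k1 hs.
  by apply: cf_if => //; [exact: cf_arc_accept|apply: cf_ccons => //; exact: cf_arc_item].
Qed.

Lemma bcodeE x y r : bcode x y r = CodeSeq.code [:: x; y; r].
Proof. by []. Qed.

Lemma rcodeE a b c : rcode a b c = CodeSeq.code [:: a; b; c].
Proof. by []. Qed.

Lemma hd_bcode x y r : hd (bcode x y r) = x.
Proof. by rewrite bcodeE hd_code. Qed.

Lemma hd_tl_bcode x y r : hd (tl (bcode x y r)) = y.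
Proof. by rewrite bcodeE tl_code hd_code. Qed.

Lemma hd_tl_tl_bcode x y r : hd (tl (tl (bcode x y r))) = r.
Proof. by rewrite bcodeE !tl_code hd_code. Qed.

Lemma leq_bcode x x' y y' r r' : (x <= x')%N -> (y <= y')%N -> (r <= r')%N ->
  (bcode x y r <= bcode x' y' r')%N.
Proof.
move=> hx hy hr; rewrite /bcode /ccons.
by do 3 (apply: leq_mul; [by rewrite leq_exp2l|rewrite ltnS leq_double]).
Qed.

Lemma rat_of_rcode a b c : rat_of_code (rcode a b c) = (a%:R - b%:R) / c.+1%:R.
Proof. by rewrite /rat_of_code rcodeE CodeSeq.codeK. Qed.

Lemma ball_of_bcode x y r :
  ball_of_code (bcode x y r) = (rat_of_code x, rat_of_code y, rat_of_code r).
Proof. by rewrite /ball_of_code bcodeE CodeSeq.codeK. Qed.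

Lemma ratr_rcode (R : realType) a b c :
  ratr (rat_of_code (rcode a b c)) = (a%:R - b%:R) / c.+1%:R :> R.
Proof. by rewrite rat_of_rcode fmorph_div rmorphB !rmorph_nat. Qed.

(** * Correctness *)

Section Perturbation.
Variable R : realType.
Implicit Types a b x y r h : R.

(** The two squares contribute 5 r h each, the two linear terms 6 r h each and the two products 2 r
    h each: 26 in all. *)
Lemma thales_perturb a b a' b' x y x' y' r h :
  1 <= r -> h <= 1 -> `|x| <= 2 * r -> `|y| <= 2 * r ->
  `|x' - x| <= h -> `|y' - y| <= h -> `|a' - a| <= h -> `|b' - b| <= h ->
  thales a b x y - 26 * r * h <= thales a' b' x' y'.
Proof.
move=> r1 h1 xr yr xx yy aa bb.
have h0 : 0 <= h by apply: le_trans xx.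
have rh : h <= r * h by rewrite ler_peMl.
have ca := le_trans (cos_lip a' a) aa; have sa := le_trans (sin_lip a' a) aa.
have cb := le_trans (cos_lip b' b) bb; have sb := le_trans (sin_lip b' b) bb.
have ca1 := cos_max a'; have sa1 := sin_max a'.
have cb1 := cos_max b'; have sb1 := sin_max b'.
have cb2 := cos_max b; have sb2 := sin_max b.
have sq t t' : `|t| <= 2 * r -> `|t' - t| <= h -> `|t' ^+ 2 - t ^+ 2| <= 5 * (r * h).
  move=> tr tt; have -> : t' ^+ 2 - t ^+ 2 = (t' - t) * ((t' - t) + 2 * t) by ring.
  rewrite normrM; have : `|(t' - t) + 2 * t| <= 5 * r.
    apply: le_trans (ler_normD _ _) _; rewrite normrM ger0_norm//; lra.
  move=> t5; apply: le_trans (ler_pM _ _ tt t5) _ => //; lra.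
have lin t t' c c' d d' : `|t| <= 2 * r -> `|t' - t| <= h -> `|c' - c| <= h ->
    `|d' - d| <= h -> `|c'| <= 1 -> `|d'| <= 1 ->
    `|t' * (c' + d') - t * (c + d)| <= 6 * (r * h).
  move=> tr tt cc dd c1 d1.
  have -> : t' * (c' + d') - t * (c + d) =
    (t' - t) * (c' + d') + t * ((c' - c) + (d' - d)) by ring.
  apply: le_trans (ler_normD _ _) _; rewrite !normrM.
  have u1 : `|c' + d'| <= 2 by apply: le_trans (ler_normD _ _) _; lra.
  have u2 : `|(c' - c) + (d' - d)| <= 2 * h by apply: le_trans (ler_normD _ _) _; lra.
  have := ler_pM (normr_ge0 _) (normr_ge0 _) tt u1.
  have := ler_pM (normr_ge0 _) (normr_ge0 _) tr u2.
  by lra.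
have prod c c' d d' : `|c' - c| <= h -> `|d' - d| <= h -> `|c'| <= 1 -> `|d| <= 1 ->
    `|c' * d' - c * d| <= 2 * (r * h).
  move=> cc dd c1 d1.
  have -> : c' * d' - c * d = c' * (d' - d) + (c' - c) * d by ring.
  apply: le_trans (ler_normD _ _) _; rewrite !normrM.
  have := ler_pM (normr_ge0 _) (normr_ge0 _) c1 dd.
  have := ler_pM (normr_ge0 _) (normr_ge0 _) cc d1.
  by lra.
have := sq _ _ xr xx; have := sq _ _ yr yy.
have := lin _ _ _ _ _ _ xr xx ca cb ca1 cb1.
have := lin _ _ _ _ _ _ yr yy sa sb sa1 sb1.
have := prod _ _ _ _ ca cb ca1 cb2; have := prod _ _ _ _ sa sb sa1 sb2.
clear; rewrite /thales -[26 * r * h]mulrA !ler_norml.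
move: (r * h) (x' * _) (x * _) (y' * _) (y * _) (cos a' * _) (cos a * _) (sin a' * _)
  (sin a * _) (x ^+ 2) (x' ^+ 2) (y ^+ 2) (y' ^+ 2).
move=> k p1 p2 p3 p4 p5 p6 p7 p8 p9 p10 p11 p12.
by move=> /andP[? ?] /andP[? ?] /andP[? ?] /andP[? ?] /andP[? ?] /andP[? ?]; lra.
Qed.

(** The difference is h ((|p|^2 - p.u) + (|p|^2 - p.v)), and p.u <= (|p|^2 + 1) / 2 <= |p|^2 for |u|
    = 1 <= |p|. *)
Lemma thales_scale a b x y h : 0 <= h -> 1 <= x ^+ 2 + y ^+ 2 ->
  thales a b x y + h ^+ 2 * (x ^+ 2 + y ^+ 2) <=
  thales a b ((1 + h) * x) ((1 + h) * y).
Proof.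
move=> h0 q1; have half c : x * cos c + y * sin c <= x ^+ 2 + y ^+ 2.
  have := cos2Dsin2 c; have := sqr_ge0 (x - cos c); have := sqr_ge0 (y - sin c).
  by move: (cos c) (sin c) => u v; rewrite !sqrrB; lra.
rewrite -subr_ge0 [X in 0 <= X](_ : _ =
  h * (2 * (x ^+ 2 + y ^+ 2) - (x * cos a + y * sin a) - (x * cos b + y * sin b))).
  by apply: mulr_ge0 => //; have := half a; have := half b; lra.
by rewrite /thales; ring.
Qed.

Lemma dist_scale x y h w : 0 <= h -> `|x| <= w -> `|y| <= w ->
  mdist (pt x y) (pt ((1 + h) * x) ((1 + h) * y)) <= 16 * (h * w).
Proof.
move=> h0 xw yw; apply: le_trans (mdist_pt _ _ _ _) _.
have e t : `|t - (1 + h) * t| = h * `|t|.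
  have -> : t - (1 + h) * t = - (h * t) by ring.
  by rewrite normrN normrM ger0_norm.
have := ler_wpM2l h0 xw; have := ler_wpM2l h0 yw; rewrite !e; lra.
Qed.

Lemma dpower_near1 n x y : (10 <= n)%N -> dpower n x y < 0 ->
  mdist (pt x y) (pt 1 0) <= 512 * 2 ^- n.
Proof.
move=> n10 F0; rewrite /dpower in F0.
have [a0 a1] := endpt_bound R false n10; have [b0 b1] := endpt_bound R true n10.
move: (endpt R n false) (endpt R n true) a0 a1 b0 b1 F0 => a b a0 a1 b0 b1 F0.
(* As 4 pi < 16, [w] bounds both angles, hence in each coordinate the distance from the centre to 1,
   and also the radius. The distance is then at most 8 (2 w + 2 w) = 512 * 2^-n. *)
set w : R := 16 * 2 ^- n.
have pw : pi * 4 * 2 ^- n <= w.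
  by rewrite /w ler_pM2r ?exp2V_gt0//; have := pihalf_lt2 R; lra.
have near c : 0 < c -> c <= w -> `|cos c - 1| <= w /\ `|sin c| <= w.
  move=> c0 cw; split.
    by apply: le_trans cw; have := cos_lip c 0; rewrite cos0 subr0 (gtr0_norm c0).
  by apply: le_trans cw; have := sin_lip c 0; rewrite sin0 !subr0 (gtr0_norm c0).
have [ca sa] := near a a0 (le_trans a1 pw); have [cb sb] := near b b0 (le_trans b1 pw).
have w0 : 0 <= w by apply: le_trans ca.
have ab : `|a - b| <= w.
  by rewrite ler_norml; apply/andP; split; have := le_trans a1 pw;
     have := le_trans b1 pw; lra.
have cab := le_trans (cos_lip a b) ab; have sab := le_trans (sin_lip a b) ab.
have center : (x - (cos a + cos b) / 2) ^+ 2 + (y - (sin a + sin b) / 2) ^+ 2 < w ^+ 2.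
  have h c : `|c| <= w -> c ^+ 2 <= w ^+ 2.
    by move=> cw; rewrite -(real_normK (num_real c)) lerXn2r// nnegrE.
  have := h _ cab; have := h _ sab; have := sqr_ge0 w; rewrite /thales in F0.
  by move: (cos a) (cos b) (sin a) (sin b) F0 => p q u v F0; nra.
have coord t u : t ^+ 2 + u ^+ 2 < w ^+ 2 -> `|t| <= w.
  move=> h; rewrite -(@ler_pXn2r _ 2%N) ?nnegrE// real_normK ?num_real//.
  by have := sqr_ge0 u; lra.
have cx := coord _ _ center; have cy : `|y - (sin a + sin b) / 2| <= w.
  by apply: coord; rewrite addrC; exact: center.
apply: le_trans (mdist_pt _ _ _ _) _; rewrite subr0.
have -> : 512 * 2 ^- n = 8 * (2 * w + 2 * w) by rewrite /w; ring.
rewrite ler_pM2l//; apply: lerD.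
  by move: ca cb cx; rewrite !ler_norml => /andP[? ?] /andP[? ?] /andP[? ?];
    apply/andP; split; lra.
by move: sa sb cy; rewrite !ler_norml => /andP[? ?] /andP[? ?] /andP[? ?];
  apply/andP; split; lra.
Qed.
End Perturbation.

(** * The grid and its acceptance test *)

Section Grid.
Variable R : realType.
Variable s : nat.
Hypothesis s10 : (10 <= s)%N.
Implicit Types x y : R.

Lemma pt_approx D : (4 * D < 2 ^ (20 * s))%N -> exists a : R,
  [/\ (pcos (2 ^ (7 * s)) (20 * s) D)%:R = (pden (2 ^ (7 * s)) (20 * s) D)%:R * cos a,
      (psin (2 ^ (7 * s)) (20 * s) D)%:R = (pden (2 ^ (7 * s)) (20 * s) D)%:R * sin a &
      `|a - 2 * pi * (D%:R / 2 ^+ (20 * s))| <= 8 * 2 ^- (7 * s)].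
Proof.
move=> hD; have M0 : (0 < 2 ^ (7 * s))%N by rewrite expn_gt0.
have [a [aC aS ad]] := circle_approx M0 (natrX R 2 (7 * s)) hD.
exists a; split=> //; rewrite /pden natrX natrD natrX natrX; [exact: aC|exact: aS].
Qed.

Lemma pden_gt0 M E D : (0 < pden M E D)%N.
Proof. by rewrite expn_gt0 addn1. Qed.

Lemma endnumE E n c : (2 * n <= E)%N ->
  2 * pi * ((endnum E n c)%:R / 2 ^+ E) = endpt R n c.
Proof.
move=> nE; have le : (2 ^ (E - 2 * n) <= 2 ^ (E - n))%N by rewrite leq_exp2l//; lia.
rewrite /endnum /endpt; congr (_ * _).
by case: c; rewrite ?natrD ?natrB ?exp2V_natr//; try lia;
  field; rewrite !expf_neq0.
Qed.

Lemma endnum_lt E n c : (10 <= n)%N -> (2 * n <= E)%N -> (4 * endnum E n c < 2 ^ E)%N.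
Proof.
move=> n10 nE; have le : (2 ^ (E - 2 * n) <= 2 ^ (E - n))%N by rewrite leq_exp2l//; lia.
have : (4 * endnum E n c <= 8 * 2 ^ (E - n))%N by rewrite /endnum; case: c; lia.
move=> /leq_ltn_trans; apply; rewrite (_ : 8 = 2 ^ 3)%N// -expnD ltn_exp2l//; lia.
Qed.

Definition gcoord a : R := (a%:R - (grid_off s)%:R) / (grid_den s)%:R.

Lemma grid_den_gt0 : 0 < (grid_den s)%:R :> R.
Proof. by rewrite ltr0n expn_gt0. Qed.

Lemma disk_ineqE a b C1 S1 X1 C2 S2 X2 (al be : R) : (0 < X1)%N -> (0 < X2)%N ->
  C1%:R = X1%:R * cos al -> S1%:R = X1%:R * sin al ->
  C2%:R = X2%:R * cos be -> S2%:R = X2%:R * sin be ->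
  disk_ineq (grid_den s) (grid_off s) a b C1 S1 X1 C2 S2 X2 =
  (0 <= thales al be (gcoord a) (gcoord b)).
Proof.
move=> X10 X20 eC1 eS1 eC2 eS2; have H0 := grid_den_gt0.
have x1 : 0 < X1%:R :> R by rewrite ltr0n.
have x2 : 0 < X2%:R :> R by rewrite ltr0n.
rewrite /disk_ineq -(@ler_nat R) -subr_ge0 !(natrD, natrM) eC1 eS1 eC2 eS2.
rewrite [X in 0 <= X](_ : _ = (grid_den s)%:R ^+ 2 * X1%:R * X2%:R *
    thales al be (gcoord a) (gcoord b)).
  by rewrite pmulr_rge0// !mulr_gt0// exprn_gt0.
by rewrite /thales /gcoord; field; rewrite gt_eqF.
Qed.

(** The rational points lie exactly on the unit circle, so the integer test is exact for a nearby
    pair of angles, the same for all grid points; approximation enters only through these angles. *)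
Lemma disk_acceptP n : (10 <= n)%N -> (n < s)%N -> exists al be : R,
  [/\ `|al - endpt R n false| <= 8 * 2 ^- (7 * s),
      `|be - endpt R n true| <= 8 * 2 ^- (7 * s) &
      forall a b, disk_accept (2 ^ (7 * s)) (20 * s) (grid_den s) (grid_off s) n a b
        = (0 <= thales al be (gcoord a) (gcoord b))].
Proof.
move=> n10 ns; have nE : (2 * n <= 20 * s)%N by lia.
have [al [aC aS ad]] := pt_approx (endnum_lt false n10 nE).
have [be [bC bS bd]] := pt_approx (endnum_lt true n10 nE).
exists al, be; rewrite -!(endnumE _ nE); split=> // a b.
by apply: disk_ineqE => //; exact: pden_gt0.
Qed.

Lemma grid_acceptP a b c : grid_accept s (bcode a b c) <->
  [/\ (a <= 2 * grid_off s)%N, (b <= 2 * grid_off s)%N,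
      1 <= gcoord a ^+ 2 + gcoord b ^+ 2 &
      forall n, (10 <= n)%N -> (n < s)%N ->
        disk_accept (2 ^ (7 * s)) (20 * s) (grid_den s) (grid_off s) n a b].
Proof.
rewrite /grid_accept hd_bcode hd_tl_bcode; have H0 := grid_den_gt0.
have -> : (grid_den s * grid_den s + 2 * grid_off s * (a + b) <=
     a * a + b * b + 2 * grid_off s * grid_off s)%N =
     (1 <= gcoord a ^+ 2 + gcoord b ^+ 2).
  rewrite -(@ler_nat R) -subr_ge0 -[RHS]subr_ge0 !(natrD, natrM).
  rewrite [X in 0 <= X](_ : _ = (grid_den s)%:R ^+ 2 *
      (gcoord a ^+ 2 + gcoord b ^+ 2 - 1)).
    by rewrite pmulr_rge0// exprn_gt0.
  by rewrite /gcoord; field; rewrite gt_eqF.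
split=> [/and4P[ha hb hq /allP hall]|[ha hb hq hall]].
  split=> // n n10 ns; rewrite -(subnK n10); apply: hall.
  by rewrite mem_iota /=; lia.
apply/and4P; split=> //; apply/allP => n; rewrite mem_iota /= => hn.
by apply: hall; lia.
Qed.

Lemma pow_small : 208 * 2 ^- s <= 1 :> R.
Proof.
have : 2 ^- s <= 2 ^- (4 + 4) :> R by apply: exp2V_le; lia.
rewrite exp2VD (_ : 2 ^- 4 = 1 / 16); last by field.
lra.
Qed.

Lemma pow_facts : exists z : R, [/\ 0 < z, 208 * z <= 1, z = 2 ^- s &
   [/\ 2 ^- (3 * s) = z ^+ 3 :> R & 2 ^- (7 * s) = z ^+ 7 :> R]].
Proof.
exists (2 ^- s); split; [exact: exp2V_gt0|exact: pow_small|by []|].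
by rewrite !exprVn -!exprM ![(s * _)%N]mulnC.
Qed.

Lemma gcoord_near x : `|x| <= 2 * 2 ^+ s -> exists2 a,
  (a <= 2 * grid_off s)%N & `|gcoord a - x| <= 2 ^- (7 * s).
Proof.
move=> xs; have H0 := grid_den_gt0.
have WE : (grid_off s)%:R = 2 * 2 ^+ s * (grid_den s)%:R :> R.
  by rewrite /grid_off /grid_den !natrX -exprS -exprD; congr (_ ^+ _); lia.
have HE : 2 ^- (7 * s) = (grid_den s)%:R^-1 :> R by rewrite natrX.
move: xs; rewrite ler_norml => /andP[xl xu].
have x0 : 0 <= x * (grid_den s)%:R + (grid_off s)%:R.
  by rewrite WE -mulrDl mulr_ge0 ?(ltW H0)//; lra.
have /andP[] := truncn_itv x0; set a := Num.truncn _ => a1 a2.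
exists a.
  rewrite -(@ler_nat R) (le_trans a1)// natrM mulr_natl mulr2n lerD2r.
  by rewrite WE ler_pM2r.
rewrite HE /gcoord -natr1 in a2 *; rewrite ler_norml; apply/andP; split.
  rewrite -(ler_pM2r H0) mulrBl divfK ?gt_eqF// mulNr mulVf ?gt_eqF//; lra.
rewrite -(ler_pM2r H0) mulrBl divfK ?gt_eqF// mulVf ?gt_eqF//; lra.
Qed.

(** The point is first dilated by 1 + 2^(-3s) and then rounded to the grid, so that the gain of the
    dilation pays for the rounding and for the inexact angles. *)
Lemma grid_near x y : out_Lambda x y -> `|x| <= 2 ^+ s -> `|y| <= 2 ^+ s ->
  exists a b, [/\ (a <= 2 * grid_off s)%N, (b <= 2 * grid_off s)%N,
    grid_accept s (bcode a b 0) &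
    mdist (pt x y) (pt (gcoord a) (gcoord b)) <= 48 * 2 ^- s].
Proof.
move=> [q1 out] xs ys; have [z [z0 z1 zE [e3 e7]]] := pow_facts.
have z3 : 0 <= z ^+ 3 by rewrite exprn_ge0 ?ltW.
have sE : 2 ^+ s = z^-1 :> R by rewrite zE invrK.
have zz : z * 2 ^+ s = 1 by rewrite sE mulfV ?gt_eqF.
have zp k : z ^+ k.+1 <= z.
  by rewrite exprS ler_piMr ?(ltW z0)// exprn_ile1 ?(ltW z0)//; lra.
have z31 : z ^+ 3 <= 1 by have := zp 2%N; lra.
have ext t : `|t| <= 2 ^+ s -> `|(1 + z ^+ 3) * t| <= 2 * 2 ^+ s.
  by move=> ts; rewrite normrM; apply: ler_pM => //; rewrite ger0_norm; lra.
have [a aW ax] := gcoord_near (ext _ xs).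
have [b bW b_y] := gcoord_near (ext _ ys).
exists a, b; move: ax b_y; rewrite e7 => ax b_y.
set x' := (1 + z ^+ 3) * x in ax; set y' := (1 + z ^+ 3) * y in b_y.
set q := x ^+ 2 + y ^+ 2 in q1; pose r := Num.sqrt q.
have q0 : 0 <= q by apply: le_trans q1.
have rq : r ^+ 2 = q by rewrite sqr_sqrtr.
have r1 : 1 <= r by rewrite -sqrtr1 ler_wsqrtr.
have coord t u : t ^+ 2 + u ^+ 2 = q -> `|(1 + z ^+ 3) * t| <= 2 * r.
  move=> tu; rewrite normrM; apply: ler_pM => //; first by rewrite ger0_norm; lra.
  rewrite -(@ler_pXn2r _ 2%N) ?nnegrE ?sqrtr_ge0// real_normK ?num_real// rq -tu.
  by rewrite lerDl sqr_ge0.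
have xr : `|x'| <= 2 * r by apply: coord (erefl _).
have yr : `|y'| <= 2 * r by apply: coord; rewrite addrC.
have z7 : 0 <= z ^+ 7 by rewrite exprn_ge0 ?ltW.
have z71 : 8 * z ^+ 7 <= 1 by have := zp 6%N; lra.
(* Loss against gain: 26 * 8 = 208, and 208 z <= 1 <= r. *)
have key : 26 * r * (8 * z ^+ 7) <= (z ^+ 3) ^+ 2 * q.
  have -> : 26 * r * (8 * z ^+ 7) = z ^+ 6 * (r * (208 * z)) by ring.
  rewrite -exprM ler_pM2l ?exprn_gt0// -rq expr2.
  by rewrite ler_pM2l ?(lt_le_trans _ r1)//; lra.
split=> //.
  apply/grid_acceptP; split=> //.
    (* For the test 1 <= |p|^2, rounding costs at most 8 r z^7, which the first-order gain 2 z^3 q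
       of the dilation covers. *)
    have sq t g : `|t| <= 2 * r -> `|g - t| <= z ^+ 7 -> t ^+ 2 - 4 * r * z ^+ 7 <= g ^+ 2.
      move=> tr gt; have := ler_pM (normr_ge0 _) (normr_ge0 _) tr gt.
      rewrite -normrM ler_norml => /andP[h _]; have := sqr_ge0 (g - t); lra.
    have := sq _ _ xr ax; have := sq _ _ yr b_y.
    have qE : x' ^+ 2 + y' ^+ 2 = (1 + z ^+ 3) ^+ 2 * q by rewrite /x' /y' /q; ring.
    have z74 : z ^+ 7 <= z ^+ 3 / 4.
      rewrite (exprD z 3 4) ler_pM2l ?exprn_gt0//; have := zp 3%N; lra.
    have h1 : r * z ^+ 7 <= q * (z ^+ 3 / 4).
      by rewrite -rq expr2 -mulrA ler_pM2l ?(lt_le_trans _ r1)//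
        (le_trans z74)// ler_peMl// divr_ge0.
    have h2 : 0 <= z ^+ 3 ^+ 2 * q by rewrite mulr_ge0// sqr_ge0.
    have e q' w : (1 + w) ^+ 2 * q' = q' + 2 * (w * q') + w ^+ 2 * q' :> R by ring.
    have h3 : 0 <= z ^+ 3 * q by rewrite mulr_ge0.
    by move: qE; rewrite e; lra.
  move=> n n10 ns; have [al [be [ha hb ->]]] := disk_acceptP n10 ns.
  rewrite e7 in ha hb; have le7 : z ^+ 7 <= 8 * z ^+ 7 by lra.
  have := thales_perturb r1 z71 xr yr (le_trans ax le7) (le_trans b_y le7) ha hb.
  apply: le_trans; have := thales_scale (endpt R n false) (endpt R n true) z3 q1.
  have := out n n10; rewrite /dpower -/q -/x' -/y' => h1 h2; lra.
apply: le_trans (metric_triangle _ (pt x' y') _) _.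
have d1 := dist_scale z3 xs ys.
have d2 := mdist_pt x' y' (gcoord a) (gcoord b).
rewrite -zE; have h : z ^+ 3 * 2 ^+ s <= z.
  by rewrite exprSr -mulrA zz mulr1; exact: zp.
have h7 := zp 6%N.
rewrite ![`|_ - gcoord _|]distrC in d2; rewrite -/x' -/y' in d1; lra.
Qed.

End Grid.

(** * Accepted centers against points of K *)

Section Centers.
Variable R : realType.
Variable A : nat -> prog.
Variable e : nat -> nat.
Hypothesis eA : forall n, (0 < n)%N -> e n = prog_code (A n).
Variable s : nat.
Hypothesis s10 : (10 <= s)%N.
Implicit Types x y t : R.

Definition grid_pt i : sphere R := pt (gcoord R s (hd i)) (gcoord R s (hd (tl i))).

(** An accepted point was tested against slightly wrong discs and may miss K; its dilation escapes
    every true disc with n < s. The dilation costs 32 z, and a disc with n >= s another 512 z, which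
    600 z covers. *)
Lemma grid_pt_Kset i : grid_accept s i ->
  exists p, Kset A p /\ mdist (grid_pt i) p <= 600 * 2 ^- s.
Proof.
have -> : grid_accept s i = grid_accept s (bcode (hd i) (hd (tl i)) 0).
  by rewrite /grid_accept hd_bcode hd_tl_bcode.
rewrite /grid_pt; move: (hd i) (hd (tl i)) => {i} a b.
move=> /(grid_acceptP R s10) [aW bW + +].
have [z [z0 z1 zE [e3 e7]]] := pow_facts R s10.
have H0 := grid_den_gt0 R s.
have WE : (grid_off s)%:R = 2 * 2 ^+ s * (grid_den s)%:R :> R.
  by rewrite /grid_off /grid_den !natrX -exprS -exprD; congr (_ ^+ _); lia.
have bnd k : (k <= 2 * grid_off s)%N -> `|gcoord R s k| <= 2 * 2 ^+ s.
  rewrite -(@ler_nat R) natrM => kW; have k0 : 0 <= k%:R :> R by [].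
  rewrite /gcoord normrM (gtr0_norm (_ : 0 < _^-1)) ?invr_gt0// ler_pdivrMr// -WE.
  by rewrite ler_norml; apply/andP; split; lra.
move: (bnd a aW) (bnd b bW); set x := gcoord R s a; set y := gcoord R s b.
move=> xs ys q1 acc; have zz : z * 2 ^+ s = 1.
  by rewrite zE mulVf// expf_neq0.
have zp k : z ^+ k.+1 <= z.
  by rewrite exprS ler_piMr ?(ltW z0)// exprn_ile1 ?(ltW z0)//; lra.
have z3 : 0 <= z ^+ 3 by rewrite exprn_ge0 ?ltW.
have z7 : 0 <= z ^+ 7 by rewrite exprn_ge0 ?ltW.
have d1 := dist_scale z3 xs ys.
have {}d1 : mdist (pt x y) (pt ((1 + z ^+ 3) * x) ((1 + z ^+ 3) * y)) <= 32 * z.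
  apply: le_trans d1 _; have : z ^+ 3 * 2 ^+ s <= z.
    by rewrite exprSr -mulrA zz mulr1; exact: zp.
  lra.
move: d1; set x' := (1 + z ^+ 3) * x; set y' := (1 + z ^+ 3) * y => d1.
rewrite -zE; have [out|nout] := pselect (out_Lambda x' y').
  exists (pt x' y'); split; last by apply: le_trans d1 _; lra.
  by apply/KsetP; constructor 2; exists x', y'.
(* If the dilated point is still in Lambda, it lies in a disc with n >= s, which is close to the
   point 1 of K. *)
exists (pt 1 0); split.
  by apply/KsetP; constructor 2; exists 1, 0; split=> //; exact: out_Lambda_1.
suff [n [n10 ns dn]] : exists n, [/\ (10 <= n)%N, (s <= n)%N & dpower n x' y' < 0].
  apply: le_trans (metric_triangle _ (pt x' y') _) _.
  have := dpower_near1 n10 dn; have := exp2V_le R ns; rewrite -zE; lra.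
set q := x ^+ 2 + y ^+ 2 in q1; pose r := Num.sqrt q.
have q0 : 0 <= q by apply: le_trans q1.
have rq : r ^+ 2 = q by rewrite sqr_sqrtr.
have r1 : 1 <= r by rewrite -sqrtr1 ler_wsqrtr.
have z31 : z ^+ 3 <= 1 by have := zp 2%N; lra.
have coord t u : t ^+ 2 + u ^+ 2 = q -> `|(1 + z ^+ 3) * t| <= 2 * r.
  move=> tu; rewrite normrM; apply: ler_pM => //; first by rewrite ger0_norm; lra.
  rewrite -(@ler_pXn2r _ 2%N) ?nnegrE ?sqrtr_ge0// real_normK ?num_real// rq -tu.
  by rewrite lerDl sqr_ge0.
have xr : `|x'| <= 2 * r by apply: coord (erefl _).
have yr : `|y'| <= 2 * r by apply: coord; rewrite addrC.
have z71 : 8 * z ^+ 7 <= 1 by have := zp 6%N; lra.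
have key : 26 * r * (8 * z ^+ 7) <= (z ^+ 3) ^+ 2 * q.
  have -> : 26 * r * (8 * z ^+ 7) = z ^+ 6 * (r * (208 * z)) by ring.
  rewrite -exprM ler_pM2l ?exprn_gt0// -rq expr2.
  by rewrite ler_pM2l ?(lt_le_trans _ r1)//; lra.
have q1' : 1 <= x' ^+ 2 + y' ^+ 2.
  have -> : x' ^+ 2 + y' ^+ 2 = (1 + z ^+ 3) ^+ 2 * q by rewrite /x' /y' /q; ring.
  by rewrite (le_trans q1)// ler_peMl// exprn_ege1//; lra.
have [n nn] : exists n, ~ ((10 <= n)%N -> 0 <= dpower n x' y').
  by apply/existsNP => h; apply: nout; split.
move/not_implyP: nn => [n10 /negP]; rewrite -ltNge => dn; exists n; split=> //.
rewrite leqNgt; apply/negP => ns.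
have [al [be [ha hb]]] := disk_acceptP R s10 n10 ns.
move=> /(_ a b); rewrite (acc n n10 ns) => /esym acc'.
(* The perturbation now goes from the approximate angles, where the test was passed, to the exact
   ones. *)
rewrite e7 in ha hb; rewrite distrC in ha; rewrite distrC in hb.
have le7 t : `|t - t| <= 8 * z ^+ 7 by rewrite subrr normr0 mulr_ge0.
have := thales_perturb r1 z71 xr yr (le7 x') (le7 y') ha hb.
have := thales_scale al be z3 q1; rewrite -/x -/y in acc'.
move: dn acc' key; rewrite /dpower -/x' -/y' -/q; lra.
Qed.

Lemma near_grid_pt x y : out_Lambda x y -> `|x| <= 2 ^+ s -> `|y| <= 2 ^+ s ->
  exists i, [/\ (i < grid_bound s)%N, grid_accept s i &
    mdist (pt x y) (grid_pt i) <= 48 * 2 ^- s].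
Proof.
move=> out xs ys; have [a [b [aW bW acc d]]] := grid_near s10 out xs ys.
exists (bcode a b 0); split=> //; first by rewrite ltnS leq_bcode.
by rewrite /grid_pt hd_bcode hd_tl_bcode.
Qed.

Lemma thales_ge0_far (a b r : R) : 3 <= r -> 0 <= thales a b r 0.
Proof.
move=> r3; rewrite /thales; have := cos_le1 a; have := cos_le1 b.
have : -1 <= cos (a - b) by exact: cos_geN1.
rewrite cosB; move: (cos a * cos b + _) => w.
by move: (cos a) (cos b) => u v; nra.
Qed.

(** The point 2^s stands in for infinity. The grid point found here also serves all points of K with
    a coordinate exceeding 2^s in absolute value. *)
Lemma inf_near_grid_pt : exists i, [/\ (i < grid_bound s)%N, grid_accept s i &
    mdist (None : sphere R) (grid_pt i) <= 56 * 2 ^- s].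
Proof.
have p0 : 0 < 2 ^+ s :> R by rewrite exprn_gt0.
have r3 : 3 <= 2 ^+ s :> R.
  rewrite -natrX ler_nat; apply: leq_trans (_ : 2 ^ 2 <= _)%N => //.
  by rewrite leq_exp2l//; lia.
have [|||i [ib iacc d]] := @near_grid_pt (2 ^+ s) 0.
- split=> [|n _]; last exact: thales_ge0_far.
  by rewrite expr0n addr0 exprn_ege1//; lra.
- by rewrite ger0_norm ?(ltW p0).
- by rewrite normr0 ltW.
exists i; split=> //; apply: le_trans (metric_triangle _ (pt (2 ^+ s) 0) _) _.
have := @mdist_inf R (2 ^+ s) 0 (2 ^+ s) p0; rewrite expr0n addr0 metric_sym.
by move=> /(_ (lexx _)); lra.
Qed.

Lemma outer_near_grid_pt (p : sphere R) : (p = None \/ exists x y, p = pt x y /\ out_Lambda x y) ->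
  exists i, [/\ (i < grid_bound s)%N, grid_accept s i &
    mdist p (grid_pt i) <= 64 * 2 ^- s].
Proof.
have z0 := exp2V_gt0 R s; have p0 : 0 < 2 ^+ s :> R by rewrite exprn_gt0.
have [i [ib iacc d]] := inf_near_grid_pt.
move=> [->|[x [y [-> out]]]]; first by exists i; split=> //; lra.
have far : 2 ^+ s ^+ 2 <= x ^+ 2 + y ^+ 2 -> exists i, [/\ (i < grid_bound s)%N,
    grid_accept s i & mdist (pt x y) (grid_pt i) <= 64 * 2 ^- s].
  move=> /(mdist_inf p0) h; exists i; split=> //.
  apply: le_trans (metric_triangle _ (None : sphere R) _) _; lra.
have big t : 2 ^+ s < `|t| -> 2 ^+ s ^+ 2 <= t ^+ 2.
  move=> h; rewrite -(real_normK (num_real t)) ler_pXn2r ?nnegrE ?(ltW p0)//.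
  exact: ltW.
have [xs|/big xs] := leP `|x| (2 ^+ s); last first.
  by apply: far; have := sqr_ge0 y; lra.
have [ys|/big ys] := leP `|y| (2 ^+ s); last first.
  by apply: far; have := sqr_ge0 x; lra.
have [k [kb kacc kd]] := near_grid_pt out xs ys.
by exists k; split=> //; lra.
Qed.

Definition arc_center n k d : nat := arc_num (20 * s) n (arc_level s (e n) n) k d.

Definition arc_pt i : sphere R :=
  let D := arc_center (hd i) (hd (tl i)) (hd (tl (tl i))) in
  let M := (2 ^ (7 * s))%N in let E := (20 * s)%N in
  pt ((pcos M E D)%:R / (pden M E D)%:R) ((psin M E D)%:R / (pden M E D)%:R).

(** An error 4 z in t is at most 32 z in angle since 2 pi <= 8, and the rational rotation adds 8
    z^7. The requirement 4 D < 2^E holds because t <= 1/8 and 4 z <= 4/208. *)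
Lemma arc_center_near n k d t : (10 <= n)%N -> Tset A n t ->
  `|(arc_center n k d)%:R / 2 ^+ (20 * s) - t| <= 4 * 2 ^- s ->
  mdist (circ t) (arc_pt (bcode n k d)) <= 40 * 2 ^- s.
Proof.
move=> n10 tn; rewrite /arc_pt hd_bcode hd_tl_bcode hd_tl_tl_bcode.
move: (arc_center n k d) => D Dt; cbv zeta.
have /andP[t0 t1] := Tset_bounds n10 tn; have n16 := exp2V_n10 R n10.
have E0 : 0 < 2 ^+ (20 * s) :> R by rewrite exprn_gt0.
have [z [z0 z1 zE [_ e7]]] := pow_facts R s10; rewrite -zE in Dt *.
have D4 : (4 * D < 2 ^ (20 * s))%N.
  rewrite -(@ltr_nat R) natrM natrX -[ltRHS]mul1r -ltr_pdivrMr// -mulrA.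
  by move: Dt; rewrite ler_norml => /andP[_]; lra.
have [a [-> -> ad]] := pt_approx R D4.
have X0 : (pden (2 ^ (7 * s)) (20 * s) D)%:R != 0 :> R.
  by rewrite pnatr_eq0 -lt0n pden_gt0.
rewrite ![_%:R * _]mulrC !mulfK// circE; apply: le_trans (mdist_circle _ _) _.
rewrite e7 in ad; have z7 : z ^+ 7 <= z.
  by rewrite exprS ler_piMr ?(ltW z0)// exprn_ile1 ?(ltW z0)//; lra.
apply: le_trans (ler_distD (2 * pi * (D%:R / 2 ^+ (20 * s))) _ _) _.
have p8 : 0 <= 2 * (pi : R) <= 8 by have := pihalf_lt2 R; have := pi_ge0 R; lra.
have : `|2 * pi * t - 2 * pi * (D%:R / 2 ^+ (20 * s))| <= 8 * (4 * z).
  rewrite -mulrBr normrM distrC; move/andP: p8 => [p0 p8].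
  by rewrite (ger0_norm p0); apply: ler_pM.
by rewrite (distrC _ a); lra.
Qed.

Lemma arc_pt_Kset i : arc_accept e s i ->
  exists p, Kset A p /\ mdist (arc_pt i) p <= 40 * 2 ^- s.
Proof.
have -> : arc_accept e s i =
    arc_accept e s (bcode (hd i) (hd (tl i)) (hd (tl (tl i)))).
  by rewrite /arc_accept hd_bcode hd_tl_bcode hd_tl_tl_bcode.
have -> : arc_pt i = arc_pt (bcode (hd i) (hd (tl i)) (hd (tl (tl i)))).
  by rewrite /arc_pt hd_bcode hd_tl_bcode hd_tl_tl_bcode.
move: (hd i) (hd (tl i)) (hd (tl (tl i))) => n k d.
rewrite /arc_accept hd_bcode hd_tl_bcode hd_tl_tl_bcode => /and3P[n10 ns].
rewrite eA; last by lia.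
move=> /(arc_Tset R n10 ns erefl erefl erefl) [t tn td].
exists (circ t); split; first by apply/KsetP; constructor 3; exists n, t.
by rewrite metric_sym; apply: arc_center_near tn _ => //; rewrite /arc_center eA//; lia.
Qed.

Lemma arc_test_bound Q E n j k d : arc_test Q E n j k d ->
  (k <= 2 ^ j.+1)%N /\ (d <= 2 ^ E)%N.
Proof.
move=> /andP[/andP[_ kj] h]; split.
  by apply: leq_trans (ltnW kj); exact: leq_addr.
rewrite -(@leq_pmul2r (Q.+1 ^ (Q * 2 ^ (2 * n + 2 * j)))) ?expn_gt0//.
apply: leq_trans h _; rewrite leq_mul2l; apply/orP; right.
by have [->//|m0] := posnP (Q * 2 ^ (2 * n + 2 * j))%N; rewrite leq_exp2r.
Qed.

Lemma circ_near_arc_pt n t : (10 <= n)%N -> (n < s)%N -> Tset A n t ->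
  exists i, [/\ (i < arc_bound s)%N, arc_accept e s i &
    mdist (circ t) (arc_pt i) <= 40 * 2 ^- s].
Proof.
move=> n10 ns tn; have [k [d [test kd]]] := Tset_arc n10 ns erefl erefl erefl tn.
have n0 : (0 < n)%N by lia.
exists (bcode n k d); split.
- have [kj dE] := arc_test_bound test; rewrite ltnS leq_bcode ?(ltnW ns)//.
  apply: leq_trans kj _; rewrite leq_exp2l// addn1 ltnS.
  by apply: (@arc_level_le A s n) erefl.
- rewrite /arc_accept hd_bcode hd_tl_bcode hd_tl_tl_bcode n10 ns eA//.
- by apply: arc_center_near tn _; rewrite // /arc_center eA.
Qed.

Definition accepted (c : sphere R) : Prop :=
  (exists i, [/\ (i < grid_bound s)%N, grid_accept s i & c = grid_pt i]) \/
  (exists i, [/\ (i < arc_bound s)%N, arc_accept e s i & c = arc_pt i]).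

Lemma accepted_Kset c : accepted c ->
  exists p, Kset A p /\ mdist c p <= 600 * 2 ^- s.
Proof.
have z0 := exp2V_gt0 R s.
case=> -[i [_ acc ->]]; first exact: grid_pt_Kset.
have [p [Kp d]] := arc_pt_Kset acc; exists p; split=> //; lra.
Qed.

Lemma Kset_accepted p : Kset A p ->
  exists c, accepted c /\ mdist p c <= 600 * 2 ^- s.
Proof.
have z0 := exp2V_gt0 R s.
have outer (q : sphere R) : (q = None \/ exists x y, q = pt x y /\ out_Lambda x y) ->
    exists c, accepted c /\ mdist q c <= 64 * 2 ^- s.
  move=> /outer_near_grid_pt[i [ib acc d]]; exists (grid_pt i); split=> //.
  by left; exists i.
move=> /KsetP[->|out|[n [t [n10 tn ->]]]].
- have [|c [ac d]] := outer None; first by left.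
  by exists c; split=> //; lra.
- have [|c [ac d]] := outer p; first by right.
  by exists c; split=> //; lra.
- have [ns|sn] := ltnP n s.
    have [i [ib acc d]] := circ_near_arc_pt n10 ns tn.
    exists (arc_pt i); split; last by lra.
    by right; exists i.
  (* Arcs with n >= s are not generated: their points are within 16 * 2^-s of 1, which an accepted
     grid point approximates. *)
  have [|c [ac d]] := outer (pt 1 0).
    by right; exists 1, 0; split=> //; exact: out_Lambda_1.
  exists c; split=> //; apply: le_trans (metric_triangle _ (pt 1 0) _) _.
  have /andP[t0 t1] := Tset_bounds n10 tn.
  have := mdist_circle (2 * pi * t) 0; rewrite cos0 sin0 -circE subr0.
  have p8 : 0 <= 2 * (pi : R) <= 8 by have := pihalf_lt2 R; have := pi_ge0 R; lra.
  move/andP: p8 => [p0 p8]; rewrite (ger0_norm (mulr_ge0 p0 t0)).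
  have := ler_pM p0 t0 p8 t1; have := exp2V_le R sn; lra.
Qed.

End Centers.

(** * From centers to balls and the Hausdorff distance *)

Section Output.
Variable R : realType.

Lemma hausdorff_dist_le (S K : set (sphere R)) (c : R) :
  (forall x, S x -> exists2 y, K y & mdist x y <= c) ->
  (forall y, K y -> exists2 x, S x & mdist y x <= c) ->
  (hausdorff_dist S K <= c%:E)%E.
Proof.
have excess (B C : set (sphere R)) : (forall x, B x -> exists2 y, C y & mdist x y <= c) ->
    (ereal_sup [set ereal_inf [set (mdist a b)%:E | b in C] | a in B] <= c%:E)%E.
  move=> BC; apply: ge_ereal_sup => _ [x Bx <-]; have [y Cy xy] := BC x Bx.
  apply: (@le_trans _ _ (mdist x y)%:E); last by rewrite lee_fin.
  by apply: ereal_inf_lbound; exists y.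
by move=> SK KS; rewrite /hausdorff_dist ge_max !excess.
Qed.

(** [closed_ball] is the closure of the open ball, so a point of it is within r of a point that is
    within r of the center; the crude factor 2 suffices. *)
Lemma closed_ball_mdist (c x : sphere R) (r : R) : 0 < r ->
  closed_ball c r x -> mdist x c <= 2 * r.
Proof.
move=> r0 /(_ (ball x r) (nbhsx_ballx _ _ r0))[y [cy xy]].
apply: le_trans (metric_triangle _ y _) _.
move: cy xy; rewrite !ballEmdist /= => cy xy; rewrite [mdist y c]metric_sym; lra.
Qed.

Lemma closed_ideal_ball_bcode (x y r : nat) : @closed_ideal_ball R (ball_of_code (bcode x y r)) =
  closed_ball (pt (ratr (rat_of_code x) : R) (ratr (rat_of_code y)))
    (ratr (rat_of_code r)).
Proof. by rewrite ball_of_bcode. Qed.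

Lemma ratr_radius s : ratr (rat_of_code (rcode 1 0 (2 ^ s).-1)) = 2 ^- s :> R.
Proof. by rewrite ratr_rcode prednK ?expn_gt0// subr0 div1r natrX. Qed.

Lemma grid_item_ball s i : @closed_ideal_ball R (ball_of_code (grid_item s i)) =
  closed_ball (grid_pt R s i) (2 ^- s).
Proof.
rewrite /grid_item closed_ideal_ball_bcode ratr_radius !ratr_rcode prednK ?expn_gt0//.
Qed.

Lemma arc_item_ball e s i : @closed_ideal_ball R (ball_of_code (arc_item e s i)) =
  closed_ball (arc_pt R e s i) (2 ^- s).
Proof.
by rewrite /arc_item closed_ideal_ball_bcode ratr_radius !ratr_rcode prednK ?pden_gt0// !subr0.
Qed.

Lemma radius_gt0 s x y : 0 < (ball_of_code (bcode x y (rcode 1 0 (2 ^ s).-1))).2.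
Proof. by rewrite ball_of_bcode /= rat_of_rcode subr0 divr_gt0. Qed.

Lemma error_constant_lt1 : 602 * 2 ^- 10 < 1 :> R.
Proof.
have e4 : 2 ^- 4 = 1 / 16 :> R by field.
have e2 : 2 ^- 2 = 1 / 4 :> R by field.
have -> : 2 ^- 10 = 2 ^- 4 * 2 ^- 4 * 2 ^- 2 :> R by rewrite -!exp2VD.
by rewrite e4 e2; lra.
Qed.

Lemma mem_balls e s b : b \in balls_of_code (alg e s) -> 0 < b.2 /\
  exists2 c : sphere R, accepted e s c & @closed_ideal_ball R b = closed_ball c (2 ^- s).
Proof.
move=> /mapP[w /mem_collect[[i [ib acc ->]] ->|/mem_collect[[i [ib acc ->]] ->|//]]].
- split; first exact: radius_gt0.
  by exists (arc_pt R e s i); [right; exists i|exact: arc_item_ball].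
- split; first exact: radius_gt0.
  by exists (grid_pt R s i); [left; exists i|exact: grid_item_ball].
Qed.

Lemma accepted_ball e s (c : sphere R) : accepted e s c ->
  exists2 b, b \in balls_of_code (alg e s) & @closed_ideal_ball R b = closed_ball c (2 ^- s).
Proof.
move=> [[i [ib acc ->]]|[i [ib acc ->]]].
- exists (ball_of_code (grid_item s i)); last exact: grid_item_ball.
  apply: map_f; apply/mem_collect; right; apply/mem_collect; left.
  by exists i.
- exists (ball_of_code (arc_item e s i)); last exact: arc_item_ball.
  by apply: map_f; apply/mem_collect; left; exists i.
Qed.

End Output.

Theorem proposition5p7 (R : realType) (A : nat -> prog)
  (hA : effective_enumeration A) :
  computable_compact (~` (Some @` Omega R A) : set (sphere R)).
Proof.
have [_ [e ce eA]] := hA; split; first exact: compact_Kset.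
exists (fun m => alg e (m + 10)); first exact: computable_alg.
move=> m balls; split=> [b /(mem_balls R)[]//|].
set s := (m + 10)%N; have s10 : (10 <= s)%N by exact: leq_addl.
have eA' n : (0 < n)%N -> e n = prog_code (A n) := eA n.
have z0 := exp2V_gt0 R s.
(* 600 for replacing a point of K by a center or conversely, plus 2 for the radius of the balls. The
   shift of [m] by 10 absorbs the constant, as 602 < 2^10. *)
apply: (@le_lt_trans _ _ (602 * 2 ^- s)%:E%R); last first.
  rewrite lte_fin /s exp2VD mulrCA gtr_pMr; last exact: exp2V_gt0.
  exact: error_constant_lt1.
apply: hausdorff_dist_le => [x [b /= /(mem_balls R)[_ [c ac ->]]]|p Kp].
  move=> /(closed_ball_mdist z0) xc.
  have [p [Kp cp]] := accepted_Kset eA' s10 ac; exists p => //.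
  by apply: le_trans (metric_triangle _ c _) _; lra.
have [c [ac pc]] := Kset_accepted eA' s10 Kp; exists c; last by lra.
have [b bb bE] := accepted_ball ac; exists b => //.
rewrite bE; apply: subset_closure; exact: ballxx.
Qed.
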